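(* Let $f=h+\overline{g}$ be a locally univalent harmonic function in a disk centered at $\alpha\in\mathbb{C}$ (with $h,g$ analytic in the disk), with $f(\alpha)=0$, and let $$F^{N_H}(z)=z-\frac{\overline{h'(z)}\,f(z)-\overline{g'(z)\,f(z)}}{|h'(z)|^2-|g'(z)|^2}$$ be the generating function of the harmonic Newton method. Then $$F^{N_H}(\alpha)=\alpha,\qquad \frac{\partial F^{N_H}}{\partial z}(\alpha)=0,\qquad \frac{\partial^2 F^{N_H}}{\partial z^2}(\alpha)=P_H(f)(\alpha),$$ where $P_H(f)$ is the harmonic pre-Schwarzian derivative of $f$.
   Context: A complex-valued function is harmonic if its real and imaginary parts are (real) harmonic. In a simply connected domain every harmonic function has a canonical decomposition $f=h+\overline{g}$ with $h,g$ analytic, unique up to an additive constant. Locally univalent means locally injective; by Lewy's theorem, $f=h+\overline g$ is locally univalent if and only if its Jacobian $J_f=|h'|^2-|g'|^2$ does not vanish. The Wirtinger operators, with $z=x+iy$, are $\frac{\partial}{\partial z}=\frac12\left(\frac{\partial}{\partial x}-i\frac{\partial}{\partial y}\right)$ and $\frac{\partial}{\partial\overline z}=\frac12\left(\frac{\partial}{\partial x}+i\frac{\partial}{\partial y}\right)$. A locally univalent harmonic $f=h+\overline g$ is orientation-preserving if $|h'|>|g'|$, and orientation-reversing otherwise (equivalently, $\overline f$ is orientation-preserving). For orientation-preserving $f$, its dilatation is the analytic function $\omega=g'/h'$ (so $|\omega|<1$), and the harmonic pre-Schwarzian derivative is $$P_H(f)=\frac{\partial}{\partial z}\log J_f=\frac{h''}{h'}-\frac{\overline{\omega}\,\omega'}{1-|\omega|^2}.$$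 For orientation-reversing $f$, $P_H(f)=P_H(\overline f)$; in both cases $P_H(f)=\frac{\partial}{\partial z}\log|J_f|$. *)

(* Defs.v *)
(* Stdlib reals with Coquelicot's complex numbers. *)
From Stdlib Require Import Reals.
From Coquelicot Require Import Coquelicot.
Open Scope C_scope.

Definition disk (c : C) (r : R) (z : C) : Prop := (Cmod (z - c) < r)%R.

(* [is_pseries] is taken over the complex normed module, so the coefficients,
   the variable and the limit are complex. *)
Definition analytic_at (k : C -> C) (c : C) : Prop :=
  exists (a : nat -> C) (rho : R), (0 < rho)%R /\
    forall z : C, disk c rho z ->
      @is_pseries C_AbsRing C_NormedModule a (z - c) (k z).

Definition analytic_on (D : C -> Prop) (k : C -> C) : Prop :=
  forall z : C, D z -> analytic_at k z.

(* A harmonic map is handled through a canonical decomposition (h, g):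
   f = h + conj g.  Its conjugate, conj f = g + conj h, has decomposition
   (g, h). *)
Definition harmonic_map (h g : C -> C) (z : C) : C := h z + Cconj (g z).

Definition locally_univalent_on (D : C -> Prop) (f : C -> C) : Prop :=
  forall z : C, D z -> exists eps : R, (0 < eps)%R /\
    forall w1 w2 : C, D w1 -> D w2 -> disk z eps w1 -> disk z eps w2 ->
      f w1 = f w2 -> w1 = w2.

Definition jacobian (h g : C -> C) (z : C) : R :=
  (Cmod (C_derive h z) ^ 2 - Cmod (C_derive g z) ^ 2)%R.

(* Partial derivatives in x and y (z = x + i y) of a complex-valued function,
   taken componentwise.  Coquelicot's [Derive] is total, hence [dx], [dy] and
   [dz] are meaningful only where [ex_dz] holds. *)
Definition dx (F : C -> C) (z : C) : C :=
  (Derive (fun t : R => Re (F (t, Im z))) (Re z),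
   Derive (fun t : R => Im (F (t, Im z))) (Re z)).

Definition dy (F : C -> C) (z : C) : C :=
  (Derive (fun t : R => Re (F (Re z, t))) (Im z),
   Derive (fun t : R => Im (F (Re z, t))) (Im z)).

(* The Wirtinger operator d/dz. *)
Definition dz (F : C -> C) (z : C) : C := (dx F z - Ci * dy F z) / 2.

Definition ex_dz (F : C -> C) (z : C) : Prop :=
  @ex_derive R_AbsRing C_R_NormedModule (fun t : R => F (t, Im z)) (Re z) /\
  @ex_derive R_AbsRing C_R_NormedModule (fun t : R => F (Re z, t)) (Im z).

Definition pre_schwarzian_preserving (h g : C -> C) : C -> C :=
  dz (fun w : C => RtoC (ln (jacobian h g w))).

(* The second branch is the pre-Schwarzian derivative of conj f, used when f is
   orientation-reversing.  The Jacobian of a locally univalent map does not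
   vanish, so its orientation on a connected domain is that at any point. *)
Definition pre_schwarzian (h g : C -> C) (z : C) : C :=
  if Rlt_dec (Cmod (C_derive g z)) (Cmod (C_derive h z))
  then pre_schwarzian_preserving h g z
  else pre_schwarzian_preserving g h z.

Definition harmonic_newton (h g : C -> C) (z : C) : C :=
  z - (Cconj (C_derive h z) * harmonic_map h g z
       - Cconj (C_derive g z * harmonic_map h g z)) / RtoC (jacobian h g z).

(* Main.v *)
Require Import Defs.
From Stdlib Require Import Reals.
From Coquelicot Require Import Coquelicot.
From Stdlib Require Import Lra Lia Ranalysis5 Wf_nat IndefiniteDescription Classical.
Open Scope C_scope.

(** Write [J] for the Jacobian and [N] for the numerator
    [conj h' * f - conj (g' * f)] of the Newton correction.  In the Wirtinger
    calculus [conj h'] and [conj g'] have zero d/dz, whereas [f] and [conj f]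
    have d/dz equal to [h'] and [g'].  Hence [dz N = J]: the correction was
    designed so that this holds.  Then
      [dz F = 1 - (J * J - N * dz J) / J^2 = N * dz J / J^2],
    and since [N] vanishes where [f] does, [dz F alpha = 0] and one more
    derivative gives [dz (dz F) alpha = dz J / J], which is the logarithmic
    derivative [dz (ln |J|)] whatever the sign of [J].  Lemmas
    [wirtinger_newton], [wirtinger_newton_dz] and [pre_schwarzian_eq] carry out
    this computation; it uses three derivatives of [h] and [g] at [alpha], which
    are provided by termwise differentiation of power series
    ([sums_to_C_derive], [analytic_at_derive]).

    All of this divides by [J], so the substance is Lewy's theorem: a locally
    injective harmonic map has nonzero Jacobian ([lewy_jacobian_neq_0]).
    Suppose [|h'(c)| = |g'(c)|].  A unimodular [kappa] can be chosen such that the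
    analytic function [phi = kappa * h + conj kappa * g] has [phi'(c) = 0], and
    [Re (kappa * f) = Re phi].  As [phi - phi(c)] vanishes to order at least two,
    the level set of [Re phi] through [c] contains at least three arms which
    leave [c] in different directions ([three_arms]).  On this level set
    [kappa * f] only varies in its imaginary part, so by injectivity [v], the
    imaginary part of [kappa * (f - f(c))], does not vanish on any arm and has
    there a constant sign.  Two of the three arms carry the same sign; on both
    of them [v] is continuous and tends to 0 at [c], so it takes a common value,
    and [f] agrees at two distinct points.

    The arms are found without an inverse function theorem.  Near a direction [e]
    with [Re (a_n * e^n) = 0], where [a_n] is the first nonzero coefficient,
    the points [c + t * e * (1 + i * s)] are used as coordinates: for small [s]
    and [t] the derivative of [Re phi] in [s] has a constant sign and dominates
    the value at [s = 0], so for each [t] there is exactly one zero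
    [s = sigma t], and uniqueness makes [sigma] continuous
    ([leading_term_arm], [monotone_zero_curve]). *)

(** * Complex derivatives *)

Lemma pow_n_Cpow (z : C) (n : nat) : @pow_n C_Ring z n = z ^ n.
Proof.
  induction n as [|n IH]; [reflexivity|].
  change (@pow_n C_Ring z (S n)) with (z * @pow_n C_Ring z n).
  now rewrite IH.
Qed.

Lemma C_eta (z : C) : (Re z, Im z) = z.
Proof. now destruct z. Qed.

Lemma im_le_Cmod (z : C) : (Rabs (Im z) <= Cmod z)%R.
Proof. eapply Rle_trans; [apply Rmax_r|apply Rmax_Cmod]. Qed.

Lemma Cconj_0 : Cconj 0 = 0.
Proof. unfold Cconj, RtoC; simpl. f_equal; ring. Qed.

Lemma disk_center (c : C) (rho : R) : (0 < rho)%R -> disk c rho c.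
Proof. intros H. unfold disk. replace (c - c) with (RtoC 0) by ring. now rewrite Cmod_0. Qed.

Notation is_cderive := (@is_derive C_AbsRing C_NormedModule).

(** The epsilon form of the derivative, in which the modulus replaces the
    uniform structure: all later estimates are made with the modulus. *)
Lemma is_cderive_iff (k : C -> C) (z l : C) :
  is_cderive k z l <->
  (forall eps : R, (0 < eps)%R -> exists d : R, (0 < d)%R /\
    forall w : C, disk z d w ->
      (Cmod (k w - k z - (w - z) * l) <= eps * Cmod (w - z))%R).
Proof.
  split.
  - intros [_ H] eps Heps.
    destruct (H z (fun P HP => HP) (mkposreal eps Heps)) as [d Hd].
    exists d; split; [apply cond_pos|].
    intros w Hw. exact (Hd w Hw).
  - intros H; split.
    + apply is_linear_scal_l.
    + intros y Hy eps.
      apply (@is_filter_lim_locally_unique C_AbsRing (AbsRing_NormedModule C_AbsRing)) in Hy.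
      subst y.
      destruct (H eps (cond_pos eps)) as [d [Hd Hk]].
      exists (mkposreal d Hd). intros w Hw. exact (Hk w Hw).
Qed.

Lemma is_cderive_quadratic (k : C -> C) (z l : C) (d K : R) :
  (0 < d)%R ->
  (forall w : C, disk z d w ->
     (Cmod (k w - k z - (w - z) * l) <= K * Cmod (w - z) ^ 2)%R) ->
  is_cderive k z l.
Proof.
  intros Hd H. apply is_cderive_iff. intros eps Heps.
  exists (Rmin d (eps / (Rabs K + 1))). split.
  - apply Rmin_glb_lt; [exact Hd|].
    apply Rdiv_lt_0_compat; [exact Heps|]. pose proof (Rabs_pos K); lra.
  - intros w Hw. unfold disk in Hw.
    assert (H1 : (Cmod (w - z) < d)%R) by (eapply Rlt_le_trans; [exact Hw|apply Rmin_l]).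
    assert (H2 : (Cmod (w - z) < eps / (Rabs K + 1))%R)
      by (eapply Rlt_le_trans; [exact Hw|apply Rmin_r]).
    specialize (H w H1). pose proof (Cmod_ge_0 (w - z)) as H3.
    pose proof (Rabs_pos K) as H4. pose proof (Rle_abs K) as H5.
    apply Rlt_div_r in H2; [|lra].
    eapply Rle_trans; [exact H|]. nra.
Qed.

Lemma is_cderive_lipschitz (k : C -> C) (z l : C) :
  is_cderive k z l ->
  exists d L : R, (0 < d)%R /\ (0 < L)%R /\
    forall w : C, disk z d w -> (Cmod (k w - k z) <= L * Cmod (w - z))%R.
Proof.
  intros H. apply is_cderive_iff with (eps := 1%R) in H; [|lra].
  destruct H as [d [Hd H]].
  exists d, (1 + Cmod l)%R. pose proof (Cmod_ge_0 l).
  repeat split; [exact Hd|lra|].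
  intros w Hw. specialize (H w Hw).
  replace (k w - k z) with ((k w - k z - (w - z) * l) + (w - z) * l) by ring.
  eapply Rle_trans; [apply Cmod_triangle|]. rewrite Cmod_mult. nra.
Qed.

(** The step from [n] to [n + 1] uses
    [E_(n+1) = w * E_n + n * z^(n-1) * (w - z)^2] for the remainder [E_n], so
    that the constants satisfy [n * (n - 1) + n <= (n + 1) * n].  The exponent
    [n - 2] is truncated, which is harmless because [E_0 = E_1 = 0]. *)
Lemma Cpow_taylor (z w : C) (B : R) (n : nat) :
  (Cmod z <= B)%R -> (Cmod w <= B)%R ->
  (Cmod (w ^ n - z ^ n - (w - z) * (INR n * z ^ (pred n)))
   <= INR n * INR (pred n) * B ^ (n - 2) * Cmod (w - z) ^ 2)%R.
Proof.
  intros Hz Hw. pose proof (Cmod_ge_0 z) as Hz0.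
  assert (HR : (0 <= B)%R) by lra.
  induction n as [|[|n] IH].
  - simpl. replace (1 - 1 - (w - z) * (0 * 1)) with (RtoC 0) by ring.
    rewrite Cmod_0. lra.
  - simpl. replace (w * 1 - z * 1 - (w - z) * (1 * 1)) with (RtoC 0) by ring.
    rewrite Cmod_0. lra.
  - replace (w ^ S (S n) - z ^ S (S n) - (w - z) * (INR (S (S n)) * z ^ pred (S (S n))))
      with (w * (w ^ S n - z ^ S n - (w - z) * (INR (S n) * z ^ pred (S n)))
            + INR (S n) * z ^ n * (w - z) ^ 2).
    2:{ simpl pred. rewrite (S_INR (S n)), RtoC_plus, !Cpow_S. simpl. ring. }
    eapply Rle_trans; [apply Cmod_triangle|].
    rewrite !Cmod_mult, !Cmod_pow, Cmod_R, (Rabs_pos_eq (INR (S n))) by apply pos_INR.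
    simpl pred in *. replace (S (S n) - 2)%nat with n by lia.
    pose proof (pow2_ge_0 (Cmod (w - z))) as HQ.
    set (Q := (Cmod (w - z) ^ 2)%R) in *. clearbody Q.
    assert (Hp : (Cmod z ^ n <= B ^ n)%R) by (apply pow_incr; lra).
    assert (Hn : (0 <= INR n)%R) by apply pos_INR.
    assert (Hstep : (Cmod w * (INR (S n) * INR n * B ^ (S n - 2) * Q)
              <= INR (S n) * INR n * B ^ n * Q)%R).
    { destruct n as [|n].
      - simpl. lra.
      - replace (S (S n) - 2)%nat with n by lia. simpl (B ^ S n)%R.
        assert (0 <= INR (S (S n)) * INR (S n) * B ^ n * Q)%R.
        { repeat apply Rmult_le_pos; try apply pos_INR; [now apply pow_le|exact HQ]. }
        nra. }
    assert (Hstep' : (Cmod w * Cmod (w ^ S n - z ^ S n - (w - z) * (INR (S n) * z ^ n))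
              <= Cmod w * (INR (S n) * INR n * B ^ (S n - 2) * Q))%R).
    { apply Rmult_le_compat_l; [apply Cmod_ge_0|exact IH]. }
    assert (Hlast : (INR (S n) * Cmod z ^ n * Q <= INR (S n) * B ^ n * Q)%R).
    { apply Rmult_le_compat_r; [exact HQ|]. apply Rmult_le_compat_l; [apply pos_INR|exact Hp]. }
    assert (Hpos : (0 <= INR (S n) * B ^ n * Q)%R).
    { repeat apply Rmult_le_pos; try apply pos_INR; [now apply pow_le|exact HQ]. }
    rewrite (S_INR (S n)). rewrite (S_INR n) in *.
    nra.
Qed.

(** * Power series *)

Notation cseries := (@is_series C_AbsRing C_NormedModule).

Lemma Cmod_series_le (c : nat -> C) (l : C) (b : nat -> R) :
  cseries c l -> (forall n, (Cmod (c n) <= b n)%R) -> ex_series b ->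
  (Cmod l <= Series b)%R.
Proof.
  intros Hc Hb Hex.
  assert (H : Rbar_le (Cmod l) (Series b)); [|exact H].
  apply (filterlim_le (F := eventually) (fun n => Cmod (@sum_n C_AbelianMonoid c n))
           (fun n => sum_n b n)).
  - exists 0%nat. intros n _.
    eapply Rle_trans; [apply (@norm_sum_n_m C_AbsRing C_NormedModule)|].
    apply sum_n_m_le. exact Hb.
  - change (filterlim (fun n => @norm C_AbsRing C_NormedModule (sum_n c n)) eventually
              (locally (@norm C_AbsRing C_NormedModule l))).
    eapply filterlim_comp; [exact Hc|].
    apply (@filterlim_norm C_AbsRing C_NormedModule l).
  - exact (Series_correct b Hex).
Qed.

(** The relational form avoids an operator for complex sums: derived series are
    attached to [C_derive k], whose values are determined by [k]. *)
Definition sums_to (a : nat -> C) (c : C) (rho : R) (k : C -> C) : Prop :=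
  forall z : C, disk c rho z -> cseries (fun n => (z - c) ^ n * a n) (k z).

Lemma sums_to_pseries (a : nat -> C) (c : C) (rho : R) (k : C -> C) :
  sums_to a c rho k <->
  (forall z : C, disk c rho z ->
     @is_pseries C_AbsRing C_NormedModule a (z - c) (k z)).
Proof.
  split; intros H z Hz; specialize (H z Hz).
  - eapply is_series_ext; [|exact H]. intros n.
    change ((z - c) ^ n * a n = @pow_n C_Ring (z - c) n * a n).
    apply (f_equal (fun t => t * a n)). symmetry. apply pow_n_Cpow.
  - eapply is_series_ext; [|exact H]. intros n.
    change (@pow_n C_Ring (z - c) n * a n = (z - c) ^ n * a n).
    apply (f_equal (fun t => t * a n)). apply pow_n_Cpow.
Qed.

Lemma sums_to_bounded (a : nat -> C) (c : C) (rho : R) (k : C -> C) (r : R) :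
  sums_to a c rho k -> (0 <= r < rho)%R ->
  exists M : R, forall n, (Cmod (a n) * r ^ n <= M)%R.
Proof.
  intros H Hr.
  specialize (H (c + r)).
  assert (Hd : disk c rho (c + r)).
  { unfold disk. replace (c + r - c) with (RtoC r) by ring.
    rewrite Cmod_R, Rabs_pos_eq; lra. }
  specialize (H Hd).
  destruct (@filterlim_bounded C_AbsRing C_NormedModule
              (sum_n (fun n => (c + r - c) ^ n * a n))) as [M HM].
  { exists (k (c + r)). exact H. }
  exists (M + M)%R. intros n.
  assert (Ht : Cmod ((c + r - c) ^ n * a n) = (Cmod (a n) * r ^ n)%R).
  { rewrite Cmod_mult, Cmod_pow. replace (c + r - c) with (RtoC r) by ring.
    rewrite Cmod_R, Rabs_pos_eq by lra. ring. }
  rewrite <- Ht.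
  assert (HM0 : (0 <= M)%R).
  { eapply Rle_trans; [apply Cmod_ge_0|apply (HM 0%nat)]. }
  destruct n as [|n].
  - generalize (HM 0%nat). rewrite sum_O. intros H0.
    change (Cmod ((c + r - c) ^ 0 * a 0%nat) <= M)%R in H0. lra.
  - generalize (HM (S n)) (HM n). rewrite sum_Sn. intros H1 H0.
    set (s := sum_n _ n) in *. set (t := (c + r - c) ^ S n * a (S n)) in *.
    change (Cmod (s + t) <= M)%R in H1. change (Cmod s <= M)%R in H0.
    replace t with ((s + t) + - s) by ring.
    eapply Rle_trans; [apply Cmod_triangle|]. rewrite Cmod_opp. lra.
Qed.

Lemma sums_to_CV_radius (a : nat -> C) (c : C) (rho : R) (k : C -> C) (x : R) :
  sums_to a c rho k -> (0 <= x < rho)%R ->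
  Rbar_lt (Rabs x) (CV_radius (fun n => Cmod (a n))).
Proof.
  intros H Hx.
  destruct (sums_to_bounded a c rho k ((x + rho) / 2) H) as [M HM]; [lra|].
  apply Rbar_lt_le_trans with ((x + rho) / 2)%R.
  - simpl. rewrite Rabs_pos_eq; lra.
  - apply CV_radius_bounded. exists M. intros n.
    rewrite Rabs_pos_eq; [apply HM|].
    apply Rmult_le_pos; [apply Cmod_ge_0|apply pow_le; lra].
Qed.

Definition coef_derive (a : nat -> C) (n : nat) : C := INR (S n) * a (S n).

Lemma coef_derive_Cmod (a : nat -> C) (n : nat) :
  Cmod (coef_derive a n) = PS_derive (fun m => Cmod (a m)) n.
Proof.
  unfold coef_derive, PS_derive. rewrite Cmod_mult, Cmod_R, Rabs_pos_eq; [reflexivity|].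
  apply pos_INR.
Qed.

Lemma sums_to_ex_derive_series (a : nat -> C) (c : C) (rho : R) (k : C -> C) (z : C) :
  sums_to a c rho k -> disk c rho z ->
  exists l, cseries (fun n => (z - c) ^ n * coef_derive a n) l.
Proof.
  intros H Hz.
  apply (@ex_series_le C_AbsRing C_CompleteNormedModule _
           (fun n => PS_derive (fun m => Cmod (a m)) n * Cmod (z - c) ^ n)%R).
  - intros n.
    change (Cmod ((z - c) ^ n * coef_derive a n)
            <= PS_derive (fun m => Cmod (a m)) n * Cmod (z - c) ^ n)%R.
    rewrite Cmod_mult, Cmod_pow, coef_derive_Cmod. lra.
  - apply (proj1 (ex_pseries_R _ _)). apply ex_pseries_derive.
    apply (sums_to_CV_radius a c rho k); [exact H|].
    split; [apply Cmod_ge_0|exact Hz].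
Qed.

Lemma sums_to_second_order_ex (a : nat -> C) (c : C) (rho : R) (k : C -> C) (x : R) :
  sums_to a c rho k -> (0 <= x < rho)%R ->
  ex_series (fun n => INR n * INR (pred n) * x ^ (n - 2) * Cmod (a n))%R.
Proof.
  intros H Hx.
  apply (proj2 (ex_series_incr_n _ 2)).
  apply ex_series_ext
    with (fun n => PS_derive (PS_derive (fun m => Cmod (a m))) n * x ^ n)%R.
  - intros n. unfold PS_derive. replace (2 + n - 2)%nat with n by lia.
    change (2 + n)%nat with (S (S n)). change (pred (S (S n))) with (S n). simpl. ring.
  - apply (proj1 (ex_pseries_R _ _)). apply ex_pseries_derive.
    rewrite CV_radius_derive. now apply (sums_to_CV_radius a c rho k).
Qed.

(** Between [z] and [w] in a closed disk of radius [x < rho], the difference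
    [k w - k z - (w - z) * l] is the series of the remainders bounded in
    [Cpow_taylor], hence is quadratic in [w - z]. *)
Lemma sums_to_is_derive (a : nat -> C) (c : C) (rho : R) (k : C -> C) (z l : C) :
  sums_to a c rho k -> disk c rho z ->
  cseries (fun n => (z - c) ^ n * coef_derive a n) l ->
  is_cderive k z l.
Proof.
  intros H Hz Hl. unfold disk in Hz.
  set (x := ((Cmod (z - c) + rho) / 2)%R).
  pose proof (Cmod_ge_0 (z - c)) as Hz0.
  assert (Hx : (0 <= x < rho)%R) by (unfold x; lra).
  apply (is_cderive_quadratic k z l ((rho - Cmod (z - c)) / 2)
    (Series (fun n => INR n * INR (pred n) * x ^ (n - 2) * Cmod (a n))%R)); [lra|].
  intros w Hw. unfold disk in Hw.
  assert (Hwx : (Cmod (w - c) <= x)%R).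
  { replace (w - c) with ((w - z) + (z - c)) by ring.
    eapply Rle_trans; [apply Cmod_triangle|]. unfold x. lra. }
  assert (Hwz : w - z = (w - c) - (z - c)) by ring.
  assert (Hdisk : disk c rho w) by (unfold disk; lra).
  (* The series for [l], shifted by one: its term of index 0 is 0, so that it can
     be subtracted termwise from the series of [k]. *)
  assert (Hl' : cseries (fun n => (w - z) * (INR n * (z - c) ^ pred n * a n)) ((w - z) * l)).
  { apply (@is_series_scal C_AbsRing C_NormedModule).
    apply is_series_decr_1.
    match goal with |- is_series _ ?v => replace v with l end.
    2:{ change (l = l + - (INR 0 * (z - c) ^ pred 0 * a 0%nat)). simpl. ring. }
    eapply is_series_ext; [|exact Hl]. intros n. unfold coef_derive.
    change ((z - c) ^ n * (INR (S n) * a (S n)) = INR (S n) * (z - c) ^ n * a (S n)).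
    ring. }
  assert (Hs : cseries (fun n => ((w - c) ^ n - (z - c) ^ n
                - (w - z) * (INR n * (z - c) ^ pred n)) * a n)
                (k w - k z - (w - z) * l)).
  { eapply is_series_ext;
      [|apply (is_series_minus _ _ _ _ (is_series_minus _ _ _ _ (H w Hdisk) (H z Hz)) Hl')].
    intros n.
    change ((w - c) ^ n * a n + - ((z - c) ^ n * a n)
      + - ((w - z) * (INR n * (z - c) ^ pred n * a n))
      = ((w - c) ^ n - (z - c) ^ n - (w - z) * (INR n * (z - c) ^ pred n)) * a n).
    ring. }
  pose proof (sums_to_second_order_ex a c rho k x H Hx) as Hex.
  eapply Rle_trans.
  - apply (Cmod_series_le _ _ (fun n => (INR n * INR (pred n) * x ^ (n - 2) * Cmod (a n))
             * Cmod (w - z) ^ 2)%R Hs).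
    + intros n. rewrite Cmod_mult, Hwz.
      assert (Hzx : (Cmod (z - c) <= x)%R) by (unfold x; lra).
      pose proof (Cpow_taylor (z - c) (w - c) x n Hzx Hwx) as HT.
      pose proof (Cmod_ge_0 (a n)).
      eapply Rle_trans; [apply Rmult_le_compat_r; [assumption|exact HT]|]. lra.
    + now apply ex_series_scal_r.
  - rewrite Series_scal_r. lra.
Qed.

Lemma sums_to_C_derive (a : nat -> C) (c : C) (rho : R) (k : C -> C) :
  sums_to a c rho k ->
  (forall z, disk c rho z -> is_cderive k z (C_derive k z)) /\
  sums_to (coef_derive a) c rho (C_derive k).
Proof.
  intros H.
  assert (H' : forall z, disk c rho z -> is_cderive k z (C_derive k z) /\
             cseries (fun n => (z - c) ^ n * coef_derive a n) (C_derive k z)).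
  { intros z Hz. destruct (sums_to_ex_derive_series a c rho k z H Hz) as [l Hl].
    pose proof (sums_to_is_derive a c rho k z l H Hz Hl) as Hd.
    rewrite (is_C_derive_unique _ _ _ Hd). now split. }
  split; intros z Hz; apply (H' z Hz).
Qed.

Lemma analytic_at_derive (k : C -> C) (c : C) :
  analytic_at k c -> is_cderive k c (C_derive k c) /\ analytic_at (C_derive k) c.
Proof.
  intros [a [rho [Hrho H]]]. apply sums_to_pseries in H.
  apply sums_to_C_derive in H. destruct H as [H1 H2]. split.
  - apply H1. unfold disk. replace (c - c) with (RtoC 0) by ring. now rewrite Cmod_0.
  - exists (coef_derive a), rho. split; [exact Hrho|]. now apply sums_to_pseries.
Qed.

(** * Curves *)

(** Componentwise derivatives match the definitions of [dx] and [dy], and make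
    the real product and quotient rules available. *)
Definition is_curve_derive (p : R -> C) (t : R) (l : C) : Prop :=
  is_derive (fun s => Re (p s)) t (Re l) /\ is_derive (fun s => Im (p s)) t (Im l).

Lemma curve_derive_opp (p : R -> C) (t : R) (l : C) :
  is_curve_derive p t l -> is_curve_derive (fun s => - p s) t (- l).
Proof.
  intros [H1 H2]. split.
  - exact (@is_derive_opp R_AbsRing R_NormedModule _ _ _ H1).
  - exact (@is_derive_opp R_AbsRing R_NormedModule _ _ _ H2).
Qed.

Lemma curve_derive_plus (p q : R -> C) (t : R) (l m : C) :
  is_curve_derive p t l -> is_curve_derive q t m ->
  is_curve_derive (fun s => p s + q s) t (l + m).
Proof.
  intros [H1 H2] [H3 H4]. split.
  - exact (@is_derive_plus R_AbsRing R_NormedModule _ _ _ _ _ H1 H3).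
  - exact (@is_derive_plus R_AbsRing R_NormedModule _ _ _ _ _ H2 H4).
Qed.

Lemma curve_derive_conj (p : R -> C) (t : R) (l : C) :
  is_curve_derive p t l -> is_curve_derive (fun s => Cconj (p s)) t (Cconj l).
Proof.
  intros [H1 H2]. split.
  - exact H1.
  - exact (@is_derive_opp R_AbsRing R_NormedModule _ _ _ H2).
Qed.

Lemma curve_derive_mult (p q : R -> C) (t : R) (l m : C) :
  is_curve_derive p t l -> is_curve_derive q t m ->
  is_curve_derive (fun s => p s * q s) t (l * q t + p t * m).
Proof.
  intros [H1 H2] [H3 H4]. split.
  - evar_last.
    + exact (@is_derive_minus R_AbsRing R_NormedModule _ _ _ _ _
        (Derive.is_derive_mult _ _ _ _ _ H1 H3) (Derive.is_derive_mult _ _ _ _ _ H2 H4)).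
    + unfold minus, plus, opp; simpl. unfold Re, Im. ring.
  - evar_last.
    + exact (@is_derive_plus R_AbsRing R_NormedModule _ _ _ _ _
        (Derive.is_derive_mult _ _ _ _ _ H1 H4) (Derive.is_derive_mult _ _ _ _ _ H2 H3)).
    + unfold plus; simpl. unfold Re, Im. ring.
Qed.

Lemma Csqr_norm_neq_0 (z : C) : z <> 0 -> (Re z ^ 2 + Im z ^ 2 <> 0)%R.
Proof. intros Hz. rewrite <- Cmod2_alt. apply pow_nonzero, Rgt_not_eq. now apply Cmod_gt_0. Qed.

Lemma curve_derive_inv (p : R -> C) (t : R) (l : C) :
  is_curve_derive p t l -> p t <> 0 ->
  is_curve_derive (fun s => / p s) t (- l / (p t * p t)).
Proof.
  intros [H1 H2] Hp. apply Csqr_norm_neq_0 in Hp.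
  pose proof (@is_derive_plus R_AbsRing R_NormedModule _ _ _ _ _
    (is_derive_pow _ 2 _ _ H1) (is_derive_pow _ 2 _ _ H2)) as HN.
  split.
  - evar_last; [exact (is_derive_div _ _ _ _ _ H1 HN Hp)|].
    revert Hp. unfold plus; simpl. unfold Re, Im.
    destruct (p t) as [x y], l as [u v]; simpl. intros Hp. field.
    split; [|intros E; apply Hp; nra].
    intros E. apply Hp. nra.
  - evar_last;
      [exact (is_derive_div _ _ _ _ _ (@is_derive_opp R_AbsRing R_NormedModule _ _ _ H2) HN Hp)|].
    revert Hp. unfold plus, opp; simpl. unfold Re, Im.
    destruct (p t) as [x y], l as [u v]; simpl. intros Hp. field.
    split; [|intros E; apply Hp; nra].
    intros E. apply Hp. nra.
Qed.

Lemma curve_derive_of_remainder (p : R -> C) (t : R) (l : C) :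
  (forall eps : R, (0 < eps)%R -> exists d : R, (0 < d)%R /\
    forall h : R, (Rabs h < d)%R ->
      (Cmod (p (t + h)%R - p t - RtoC h * l) <= eps * Rabs h)%R) ->
  is_curve_derive p t l.
Proof.
  intros H.
  (* [part] stands for [Re] or [Im]. *)
  assert (Hpart : forall (part : C -> R),
    (forall z : C, (Rabs (part z) <= Cmod z)%R) ->
    (forall (x y : C) (h : R) (z : C),
       part (x - y - RtoC h * z) = (part x - part y - h * part z)%R) ->
    is_derive (fun s => part (p s)) t (part l)).
  { intros part Hle Hlin. apply is_derive_Reals. intros eps Heps.
    destruct (H (eps / 2)%R) as [d [Hd Hr]]; [lra|].
    exists (mkposreal d Hd). simpl. intros h Hh Hhd.
    specialize (Hr h Hhd).
    pose proof (Hle (p (t + h)%R - p t - RtoC h * l)) as H1. rewrite Hlin in H1.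
    pose proof (Rabs_pos_lt h Hh) as H2.
    replace ((part (p (t + h)%R) - part (p t)) / h - part l)%R
      with ((part (p (t + h)%R) - part (p t) - h * part l) / h)%R by (field; exact Hh).
    unfold Rdiv. rewrite Rabs_mult, Rabs_inv.
    apply Rle_lt_trans with (eps / 2)%R; [|lra].
    apply Rle_div_l; [exact H2|]. lra. }
  split; apply Hpart.
  - apply re_le_Cmod.
  - intros [x1 x2] [y1 y2] h [z1 z2]. simpl. ring.
  - apply im_le_Cmod.
  - intros [x1 x2] [y1 y2] h [z1 z2]. simpl. ring.
Qed.

Lemma curve_derive_line (k : C -> C) (p q : C) (t : R) (l : C) :
  is_cderive k (p + RtoC t * q) l ->
  is_curve_derive (fun s => k (p + RtoC s * q)) t (l * q).
Proof.
  intros H. apply curve_derive_of_remainder. intros eps Heps.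
  apply is_cderive_iff with (eps := (eps / (Cmod q + 1))%R) in H.
  2:{ apply Rdiv_lt_0_compat; [exact Heps|]. pose proof (Cmod_ge_0 q); lra. }
  destruct H as [d [Hd H]]. pose proof (Cmod_ge_0 q) as Hq.
  exists (d / (Cmod q + 1))%R. split; [apply Rdiv_lt_0_compat; lra|].
  intros h Hh. apply Rlt_div_r in Hh; [|lra].
  assert (E : p + RtoC (t + h) * q - (p + RtoC t * q) = RtoC h * q)
    by (rewrite RtoC_plus; ring).
  specialize (H (p + RtoC (t + h) * q)). unfold disk in H. rewrite E in H.
  rewrite Cmod_mult, Cmod_R in H. pose proof (Rabs_pos h).
  assert (Hlt : (Rabs h * Cmod q < d)%R) by nra.
  specialize (H Hlt).
  replace (RtoC h * (l * q)) with (RtoC h * q * l) by ring.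
  eapply Rle_trans; [exact H|].
  assert (E2 : (eps = eps / (Cmod q + 1) * (Cmod q + 1))%R) by (field; lra).
  assert (0 < eps / (Cmod q + 1))%R by (apply Rdiv_lt_0_compat; lra).
  rewrite E2 at 2. set (e := (eps / (Cmod q + 1))%R) in *. clearbody e.
  nra.
Qed.

(** * Wirtinger derivatives *)

(** [a] and [b] are the values of d/dz and d/d(conj z): then the partial
    derivative in x is [a + b] and that in y is [i * (a - b)].  Carrying [b]
    along makes the pair stable under conjugation, which exchanges the two
    operators. *)
Definition is_wirtinger (F : C -> C) (z a b : C) : Prop :=
  is_curve_derive (fun t => F (t, Im z)) (Re z) (a + b) /\
  is_curve_derive (fun t => F (Re z, t)) (Im z) (Ci * (a - b)).

Lemma curve_derive_eq (p : R -> C) (t : R) (l m : C) :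
  is_curve_derive p t l -> l = m -> is_curve_derive p t m.
Proof. now intros H <-. Qed.

Lemma wirtinger_opp (F : C -> C) (z a b : C) :
  is_wirtinger F z a b -> is_wirtinger (fun w => - F w) z (- a) (- b).
Proof.
  intros [H1 H2]. split.
  - eapply curve_derive_eq; [apply (curve_derive_opp _ _ _ H1)|ring].
  - eapply curve_derive_eq; [apply (curve_derive_opp _ _ _ H2)|ring].
Qed.

Lemma wirtinger_plus (F G : C -> C) (z a b a' b' : C) :
  is_wirtinger F z a b -> is_wirtinger G z a' b' ->
  is_wirtinger (fun w => F w + G w) z (a + a') (b + b').
Proof.
  intros [H1 H2] [H3 H4]. split.
  - eapply curve_derive_eq; [apply (curve_derive_plus _ _ _ _ _ H1 H3)|ring].
  - eapply curve_derive_eq; [apply (curve_derive_plus _ _ _ _ _ H2 H4)|ring].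
Qed.

Lemma wirtinger_minus (F G : C -> C) (z a b a' b' : C) :
  is_wirtinger F z a b -> is_wirtinger G z a' b' ->
  is_wirtinger (fun w => F w - G w) z (a - a') (b - b').
Proof. intros H1 H2. apply wirtinger_plus; [exact H1|now apply wirtinger_opp]. Qed.

Lemma wirtinger_mult (F G : C -> C) (z a b a' b' : C) :
  is_wirtinger F z a b -> is_wirtinger G z a' b' ->
  is_wirtinger (fun w => F w * G w) z (a * G z + F z * a') (b * G z + F z * b').
Proof.
  intros [H1 H2] [H3 H4]. split.
  - eapply curve_derive_eq; [apply (curve_derive_mult _ _ _ _ _ H1 H3)|].
    cbv beta. rewrite C_eta. ring.
  - eapply curve_derive_eq; [apply (curve_derive_mult _ _ _ _ _ H2 H4)|].
    cbv beta. rewrite C_eta. ring.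
Qed.

Lemma wirtinger_conj (F : C -> C) (z a b : C) :
  is_wirtinger F z a b -> is_wirtinger (fun w => Cconj (F w)) z (Cconj b) (Cconj a).
Proof.
  intros [H1 H2]. split.
  - eapply curve_derive_eq; [apply (curve_derive_conj _ _ _ H1)|].
    rewrite Cplus_conj. ring.
  - eapply curve_derive_eq; [apply (curve_derive_conj _ _ _ H2)|].
    destruct a, b. unfold Cconj, Ci, Cmult, Cminus, Cplus, Copp; simpl. f_equal; ring.
Qed.

Lemma wirtinger_inv (F : C -> C) (z a b : C) :
  is_wirtinger F z a b -> F z <> 0 ->
  is_wirtinger (fun w => / F w) z (- a / (F z * F z)) (- b / (F z * F z)).
Proof.
  intros [H1 H2] HF. split.
  - eapply curve_derive_eq.
    + apply (curve_derive_inv _ _ _ H1). cbv beta. now rewrite C_eta.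
    + cbv beta. rewrite C_eta. now field.
  - eapply curve_derive_eq.
    + apply (curve_derive_inv _ _ _ H2). cbv beta. now rewrite C_eta.
    + cbv beta. rewrite C_eta. now field.
Qed.

Lemma wirtinger_analytic (k : C -> C) (z l : C) :
  is_cderive k z l -> is_wirtinger k z l 0.
Proof.
  intros H. split.
  - pose proof (curve_derive_line k (0, Im z)%R 1 (Re z) l) as L.
    assert (E : forall t : R, (0, Im z)%R + RtoC t * 1 = (t, Im z)).
    { intros t. unfold Cplus, Cmult, RtoC; simpl. f_equal; ring. }
    rewrite E, C_eta in L. specialize (L H). destruct L as [L1 L2].
    apply curve_derive_eq with (l * 1); [|ring].
    split.
    + eapply is_derive_ext; [|exact L1]. intros t. cbv beta. now rewrite E.
    + eapply is_derive_ext; [|exact L2]. intros t. cbv beta. now rewrite E.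
  - pose proof (curve_derive_line k (Re z, 0)%R Ci (Im z) l) as L.
    assert (E : forall t : R, (Re z, 0)%R + RtoC t * Ci = (Re z, t)).
    { intros t. unfold Cplus, Cmult, RtoC, Ci; simpl. f_equal; ring. }
    rewrite E, C_eta in L. specialize (L H). destruct L as [L1 L2].
    apply curve_derive_eq with (l * Ci); [|ring].
    split.
    + eapply is_derive_ext; [|exact L1]. intros t. cbv beta. now rewrite E.
    + eapply is_derive_ext; [|exact L2]. intros t. cbv beta. now rewrite E.
Qed.

Lemma wirtinger_id (z : C) : is_wirtinger (fun w => w) z 1 0.
Proof.
  apply wirtinger_analytic, is_cderive_iff. intros eps Heps. exists 1%R.
  split; [lra|]. intros w _. replace (w - z - (w - z) * 1) with (RtoC 0) by ring.
  rewrite Cmod_0. pose proof (Cmod_ge_0 (w - z)). nra.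
Qed.

Lemma wirtinger_ext_loc (F G : C -> C) (z a b : C) (eps : R) :
  (0 < eps)%R -> (forall w, disk z eps w -> F w = G w) ->
  is_wirtinger F z a b -> is_wirtinger G z a b.
Proof.
  intros Heps HFG.
  assert (Hx : locally (Re z) (fun t => F (t, Im z) = G (t, Im z))).
  { exists (mkposreal eps Heps). intros t Ht. apply HFG. unfold disk.
    replace ((t, Im z) - z) with (RtoC (t - Re z)%R).
    - rewrite Cmod_R. exact Ht.
    - destruct z. unfold RtoC, Cminus, Cplus, Copp; simpl. f_equal; ring. }
  assert (Hy : locally (Im z) (fun t => F (Re z, t) = G (Re z, t))).
  { exists (mkposreal eps Heps). intros t Ht. apply HFG. unfold disk.
    replace ((Re z, t) - z) with (Ci * RtoC (t - Im z)%R).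
    - rewrite Cmod_mult, Cmod_Ci, Cmod_R, Rmult_1_l. exact Ht.
    - destruct z. unfold RtoC, Ci, Cminus, Cmult, Cplus, Copp; simpl. f_equal; ring. }
  intros [[H1 H2] [H3 H4]].
  split; split.
  - eapply is_derive_ext_loc; [|exact H1].
    eapply filter_imp; [|exact Hx]. intros t E. exact (f_equal Re E).
  - eapply is_derive_ext_loc; [|exact H2].
    eapply filter_imp; [|exact Hx]. intros t E. exact (f_equal Im E).
  - eapply is_derive_ext_loc; [|exact H3].
    eapply filter_imp; [|exact Hy]. intros t E. exact (f_equal Re E).
  - eapply is_derive_ext_loc; [|exact H4].
    eapply filter_imp; [|exact Hy]. intros t E. exact (f_equal Im E).
Qed.

(** The partial derivatives of a real function are real, although [a] and [b]
    need not be; this is why the chain rule is applied to the curves. *)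
Lemma wirtinger_ln (u : C -> R) (z a b : C) :
  is_wirtinger (fun w => RtoC (u w)) z a b -> (0 < u z)%R ->
  is_wirtinger (fun w => RtoC (ln (u w))) z (a / RtoC (u z)) (b / RtoC (u z)).
Proof.
  assert (Hcurve : forall (p : R -> R) t l, is_curve_derive (fun s => RtoC (p s)) t l ->
    (0 < p t)%R -> is_curve_derive (fun s => RtoC (ln (p s))) t (l / RtoC (p t))).
  { intros p t l [H1 H2] Hp. simpl in H1, H2.
    assert (HI : Im l = 0%R).
    { rewrite <- (is_derive_unique _ _ _ H2). apply Derive_const. }
    assert (E : l / RtoC (p t) = RtoC (Re l / p t)).
    { rewrite <- (C_eta l) at 1. rewrite HI. change ((Re l, 0%R)) with (RtoC (Re l)).
      rewrite RtoC_div; [reflexivity|lra]. }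
    rewrite E. split; simpl.
    - exact (is_derive_comp ln p t _ _ (is_derive_ln _ Hp) H1).
    - apply (@is_derive_const R_AbsRing R_NormedModule). }
  intros [H1 H2] Hu.
  assert (Hu' : RtoC (u z) <> 0) by (intros E; apply RtoC_inj in E; lra).
  split.
  - eapply curve_derive_eq.
    + apply (Hcurve (fun t => u (t, Im z))); [exact H1|]. now rewrite C_eta.
    + rewrite C_eta. now field.
  - eapply curve_derive_eq.
    + apply (Hcurve (fun t => u (Re z, t))); [exact H2|]. now rewrite C_eta.
    + rewrite C_eta. now field.
Qed.

Lemma wirtinger_dz (F : C -> C) (z a b : C) : is_wirtinger F z a b -> dz F z = a.
Proof.
  intros [[H1 H2] [H3 H4]]. unfold dz.
  assert (Ex : dx F z = a + b)
    by (apply injective_projections;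
        [exact (is_derive_unique _ _ _ H1)|exact (is_derive_unique _ _ _ H2)]).
  assert (Ey : dy F z = Ci * (a - b))
    by (apply injective_projections;
        [exact (is_derive_unique _ _ _ H3)|exact (is_derive_unique _ _ _ H4)]).
  rewrite Ex, Ey.
  replace (a + b - Ci * (Ci * (a - b))) with (a + b - (Ci * Ci) * (a - b)) by ring.
  replace (Ci * Ci) with (- (1)).
  - field.
  - unfold Ci, Cmult, Copp, RtoC; simpl. f_equal; ring.
Qed.

(** [ex_dz] refers to the product norm on pairs, which is bounded here so that
    it can be treated by components. *)
Lemma C_R_norm_le (v : C) :
  (@norm R_AbsRing C_R_NormedModule v <= Rabs (Re v) + Rabs (Im v))%R.
Proof.
  change (sqrt (Rabs (Re v) ^ 2 + Rabs (Im v) ^ 2) <= Rabs (Re v) + Rabs (Im v))%R.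
  pose proof (Rabs_pos (Re v)). pose proof (Rabs_pos (Im v)).
  apply Rsqr_incr_0_var; [|lra]. rewrite Rsqr_sqrt by nra. unfold Rsqr. nra.
Qed.

Lemma curve_derive_ex_derive (p : R -> C) (t : R) (l : C) :
  is_curve_derive p t l -> @ex_derive R_AbsRing C_R_NormedModule p t.
Proof.
  intros [H1 H2]. exists l. destruct H1 as [_ H1], H2 as [_ H2].
  split.
  - apply is_linear_scal_l.
  - intros x Hx eps.
    assert (He : (0 < eps / 2)%R) by (destruct eps; simpl; lra).
    specialize (H1 x Hx (mkposreal _ He)). specialize (H2 x Hx (mkposreal _ He)).
    eapply filter_imp; [|exact (filter_and _ _ H1 H2)].
    cbv beta. simpl. intros y [A B].
pose proof (C_R_norm_le
      (minus (minus (p y) (p x)) (@scal R_AbsRing C_R_NormedModule (minus y x) l))) as Hn.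
    eapply Rle_trans; [exact Hn|].
    eapply Rle_trans; [exact (Rplus_le_compat _ _ _ _ A B)|].
    lra.
Qed.

Lemma wirtinger_ex_dz (F : C -> C) (z a b : C) : is_wirtinger F z a b -> ex_dz F z.
Proof. intros [H1 H2]. split; eapply curve_derive_ex_derive; eassumption. Qed.

(** * Leading terms *)

Lemma cseries_zero : cseries (fun _ => RtoC 0) (RtoC 0).
Proof.
  eapply filterlim_ext; [|apply filterlim_const].
  intros n. symmetry. induction n as [|n IH].
  - apply sum_O.
  - rewrite sum_Sn, IH. change (RtoC 0 + RtoC 0 = RtoC 0). ring.
Qed.

Lemma cseries_single (n : nat) (v : C) :
  cseries (fun j => if Nat.eqb j n then v else RtoC 0) v.
Proof.
  induction n as [|n IH]; apply is_series_decr_1.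
  - match goal with |- is_series _ ?l => replace l with (RtoC 0) end.
    2:{ change (RtoC 0 = v + - v). ring. }
    eapply is_series_ext; [|exact cseries_zero]. intros n. reflexivity.
  - match goal with |- is_series _ ?l => replace l with v end.
    2:{ change (v = v + - RtoC 0). ring. }
    eapply is_series_ext; [|exact IH]. intros j. reflexivity.
Qed.

Lemma sums_to_center (a : nat -> C) (c : C) (rho : R) (k : C -> C) :
  (0 < rho)%R -> sums_to a c rho k -> k c = a 0%nat.
Proof.
  intros Hrho H. specialize (H c (disk_center c rho Hrho)).
  assert (H' : cseries (fun n => (c - c) ^ n * a n) (a 0%nat)).
  { eapply is_series_ext; [|exact (cseries_single 0 (a 0%nat))].
    intros [|n]; simpl.
    - change (a 0%nat = 1 * a 0%nat). ring.
    - change (RtoC 0 = (c - c) * (c - c) ^ n * a (S n)). ring. }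
  exact (filterlim_locally_unique (V := C_NormedModule) _ _ _ H H').
Qed.

(** With [x = rho / 2] and [q = |z - c| / x <= 1], the terms after the [n]-th
    are at most [|a_j| x^j q^(n+1)], and [|a_j| x^j] is summable: their sum is
    [O(|z - c|^(n+1))]. *)
Lemma sums_to_leading_term (a : nat -> C) (c : C) (rho : R) (k : C -> C) (n : nat) (eps : R) :
  (0 < rho)%R -> sums_to a c rho k -> (1 <= n)%nat ->
  (forall j, (1 <= j < n)%nat -> a j = 0) -> (0 < eps)%R ->
  exists d : R, (0 < d)%R /\ forall z, disk c d z ->
    (Cmod (k z - k c - (z - c) ^ n * a n) <= eps * Cmod (z - c) ^ n)%R.
Proof.
  intros Hrho H Hn Ha Heps.
  set (x := (rho / 2)%R).
  assert (Hx : (0 < x < rho)%R) by (unfold x; lra).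
  assert (Hex : ex_series (fun j => Cmod (a j) * x ^ j)%R).
  { eapply ex_series_ext.
    2:{ apply CV_disk_inside. apply (sums_to_CV_radius a c rho k x H). lra. }
    intros j. apply Rabs_pos_eq. apply Rmult_le_pos; [apply Cmod_ge_0|apply pow_le; lra]. }
  set (K := Series (fun j => Cmod (a j) * x ^ j)%R).
  assert (HK : (0 <= K)%R).
  { unfold K. rewrite <- (Rmult_0_l K) at 1. unfold K. rewrite <- Series_scal_l.
    apply Series_le; [|exact Hex]. intros j.
    assert (0 <= Cmod (a j) * x ^ j)%R
      by (apply Rmult_le_pos; [apply Cmod_ge_0|apply pow_le; lra]). lra. }
  set (L := (K / x ^ S n)%R).
  assert (HL : (0 <= L)%R).
  { apply Rmult_le_pos; [exact HK|]. left. apply Rinv_0_lt_compat, pow_lt. lra. }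
  exists (Rmin x (eps / (L + 1))). split.
  { apply Rmin_glb_lt; [lra|]. apply Rdiv_lt_0_compat; lra. }
  intros z Hz. unfold disk in Hz.
  assert (Hz1 : (Cmod (z - c) < x)%R) by (eapply Rlt_le_trans; [exact Hz|apply Rmin_l]).
  assert (Hz2 : (Cmod (z - c) < eps / (L + 1))%R)
    by (eapply Rlt_le_trans; [exact Hz|apply Rmin_r]).
  apply Rlt_div_r in Hz2; [|lra].
  assert (Hd : disk c rho z) by (unfold disk; lra).
  pose proof (Cmod_ge_0 (z - c)) as Hz0.
  set (q := (Cmod (z - c) / x)%R).
  assert (Hq : (0 <= q <= 1)%R).
  { unfold q. split; [apply Rdiv_le_0_compat; lra|]. apply Rle_div_l; lra. }
  assert (Hzq : (Cmod (z - c) = q * x)%R) by (unfold q; field; lra).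
  pose proof (is_series_minus _ _ _ _
    (is_series_minus _ _ _ _ (H z Hd) (cseries_single 0 (a 0%nat)))
    (cseries_single n ((z - c) ^ n * a n))) as Hs.
  rewrite <- (sums_to_center a c rho k Hrho H) in Hs.
  change (cseries (fun j => (z - c) ^ j * a j
      + - (if Nat.eqb j 0 then k c else RtoC 0)
      + - (if Nat.eqb j n then (z - c) ^ n * a n else RtoC 0))
    (k z - k c - (z - c) ^ n * a n)) in Hs.
  eapply Rle_trans.
  - apply (Cmod_series_le _ _ (fun j => Cmod (a j) * x ^ j * q ^ S n)%R Hs).
    + intros j.
      assert (Hpos : (0 <= Cmod (a j) * x ^ j * q ^ S n)%R).
      { apply Rmult_le_pos; [apply Rmult_le_pos; [apply Cmod_ge_0|]|]; apply pow_le; lra. }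
      destruct (Nat.eqb_spec j 0) as [->|Hj0]; [|destruct (Nat.eqb_spec j n) as [->|Hjn]].
      * destruct (Nat.eqb_spec 0 n); [lia|].
        replace ((z - c) ^ 0 * a 0%nat + - k c + - RtoC 0) with (RtoC 0).
        -- now rewrite Cmod_0.
        -- rewrite (sums_to_center a c rho k Hrho H). simpl. ring.
      * replace ((z - c) ^ n * a n + - RtoC 0 + - ((z - c) ^ n * a n)) with (RtoC 0) by ring.
        now rewrite Cmod_0.
      * replace ((z - c) ^ j * a j + - RtoC 0 + - RtoC 0) with ((z - c) ^ j * a j) by ring.
        destruct (Nat.lt_ge_cases j n) as [Hlt|Hge].
        -- rewrite (Ha j) at 1 by lia. rewrite Cmult_0_r, Cmod_0. exact Hpos.
        -- rewrite Cmod_mult, Cmod_pow, Hzq, Rpow_mult_distr.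
           replace j with (S n + (j - S n))%nat at 1 by lia. rewrite pow_add.
           assert (q ^ (j - S n) <= 1)%R.
           { rewrite <- (pow1 (j - S n)). apply pow_incr. lra. }
           assert (0 <= q ^ (j - S n))%R by (apply pow_le; lra).
           assert (0 <= q ^ S n)%R by (apply pow_le; lra).
           assert (0 <= x ^ j)%R by (apply pow_le; lra).
           pose proof (Cmod_ge_0 (a j)).
           assert (Hle : (q ^ S n * q ^ (j - S n) <= q ^ S n)%R) by nra.
           replace (q ^ S n * q ^ (j - S n) * x ^ j * Cmod (a j))%R
             with ((Cmod (a j) * x ^ j) * (q ^ S n * q ^ (j - S n)))%R by ring.
           apply Rmult_le_compat_l; [|exact Hle]. now apply Rmult_le_pos.
    + now apply ex_series_scal_r.
  - rewrite Series_scal_r. fold K.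
    replace (K * q ^ S n)%R with (L * Cmod (z - c) * Cmod (z - c) ^ n)%R.
    + apply Rmult_le_compat_r; [apply pow_le; exact Hz0|]. nra.
    + rewrite Hzq. unfold L. rewrite Rpow_mult_distr. simpl. field.
      split; [apply pow_nonzero|]; lra.
Qed.

Lemma sums_to_constant (a : nat -> C) (c : C) (rho : R) (k : C -> C) (z : C) :
  sums_to a c rho k -> (forall j, (1 <= j)%nat -> a j = 0) -> disk c rho z -> k z = k c.
Proof.
  intros H Ha Hz.
  assert (Hrho : (0 < rho)%R).
  { unfold disk in Hz. pose proof (Cmod_ge_0 (z - c)). lra. }
  rewrite (sums_to_center a c rho k Hrho H).
  apply (filterlim_locally_unique (V := C_NormedModule) _ _ _ (H z Hz)).
  change (cseries (fun n => (z - c) ^ n * a n) (a 0%nat)).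
  eapply is_series_ext; [|exact (cseries_single 0 (a 0%nat))].
  intros [|n]; simpl.
  - change (a 0%nat = 1 * a 0%nat). ring.
  - rewrite Ha by lia. change (RtoC 0 = (z - c) * (z - c) ^ n * RtoC 0). ring.
Qed.

(** * Zero curves of a real function *)

(** A one-dimensional implicit function theorem.  Since the zero is unique and
    [U t] increasing, sign conditions at two points [s1 < sigma t0 < s2] localise
    it; they persist for nearby [t], so continuity in [t] at fixed [s] suffices. *)
Lemma monotone_zero_curve (U : R -> R -> R) (delta T : R) :
  (0 < delta)%R ->
  (forall t, 0 < t < T -> forall s s', - delta <= s -> s < s' -> s' <= delta ->
     U t s < U t s')%R ->
  (forall t, (0 < t < T)%R -> forall s, (- delta <= s <= delta)%R -> continuity_pt (U t) s) ->
  (forall t, 0 < t < T -> U t (- delta)%R < 0 < U t delta)%R ->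
  (forall s, (- delta <= s <= delta)%R -> forall t, (0 < t < T)%R ->
     continuity_pt (fun t => U t s) t) ->
  exists sigma : R -> R, forall t, (0 < t < T)%R ->
    (Rabs (sigma t) <= delta)%R /\ U t (sigma t) = 0%R /\ continuity_pt sigma t.
Proof.
  intros Hdelta Hmono Hcont Hsign Hcontt.
  assert (Hex : forall t, exists s, (0 < t < T)%R ->
            ((- delta <= s <= delta)%R /\ U t s = 0%R)).
  { intros t. destruct (classic (0 < t < T)%R) as [Ht|Ht].
    - destruct (IVT_interv (U t) (- delta) delta (Hcont t Ht)) as [s Hs];
        [lra|apply (Hsign t Ht)|apply (Hsign t Ht)|].
      exists s. intros _. exact Hs.
    - exists 0%R. intros Ht'. contradiction. }
  destruct (functional_choice _ Hex) as [sigma Hsig]. exists sigma.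
  intros t0 Ht0.
  destruct (Hsig t0 Ht0) as [Hb Hz]. repeat split; [|exact Hz|].
  { apply Rabs_le. exact Hb. }
  destruct (Hsign t0 Ht0) as [Hl Hr].
  assert (Hb1 : (- delta < sigma t0)%R).
  { destruct (Req_dec (sigma t0) (- delta)) as [E|]; [rewrite E in Hz|]; lra. }
  assert (Hb2 : (sigma t0 < delta)%R).
  { destruct (Req_dec (sigma t0) delta) as [E|]; [rewrite E in Hz|]; lra. }
  intros eps Heps.
  set (s1 := Rmax (- delta) (sigma t0 - eps / 2)).
  set (s2 := Rmin delta (sigma t0 + eps / 2)).
  assert (Hs1 : (- delta <= s1 < sigma t0)%R).
  { unfold s1. split; [apply Rmax_l|]. apply Rmax_lub_lt; lra. }
  assert (Hs2 : (sigma t0 < s2 <= delta)%R).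
  { unfold s2. split; [|apply Rmin_l]. apply Rmin_glb_lt; lra. }
  assert (Hs1' : (sigma t0 - eps / 2 <= s1)%R) by apply Rmax_r.
  assert (Hs2' : (s2 <= sigma t0 + eps / 2)%R) by apply Rmin_r.
  assert (HU1 : (U t0 s1 < 0)%R) by (rewrite <- Hz; apply Hmono; lra).
  assert (HU2 : (0 < U t0 s2)%R) by (rewrite <- Hz; apply Hmono; lra).
  destruct (Hcontt s1 ltac:(lra) t0 Ht0 (- U t0 s1)%R ltac:(lra)) as [d1 [Hd1 HC1]].
  destruct (Hcontt s2 ltac:(lra) t0 Ht0 (U t0 s2)%R ltac:(lra)) as [d2 [Hd2 HC2]].
  exists (Rmin (Rmin d1 d2) (Rmin t0 (T - t0))). split.
  { repeat apply Rmin_glb_lt; lra. }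
  intros t [[_ Hne] Ht]. simpl in *. unfold Rdist in *.
  assert (HA : (Rabs (t - t0) < d1)%R)
    by (eapply Rlt_le_trans; [exact Ht|]; eapply Rle_trans; apply Rmin_l).
  assert (HB : (Rabs (t - t0) < d2)%R)
    by (eapply Rlt_le_trans; [exact Ht|]; eapply Rle_trans; [apply Rmin_l|apply Rmin_r]).
  assert (HD : (Rabs (t - t0) < t0)%R)
    by (eapply Rlt_le_trans; [exact Ht|]; eapply Rle_trans; [apply Rmin_r|apply Rmin_l]).
  assert (HE : (Rabs (t - t0) < T - t0)%R)
    by (eapply Rlt_le_trans; [exact Ht|]; eapply Rle_trans; apply Rmin_r).
  apply Rabs_def2 in HD. apply Rabs_def2 in HE.
  assert (Htt : (0 < t < T)%R) by lra.
  specialize (HC1 t (conj (conj I Hne) HA)). specialize (HC2 t (conj (conj I Hne) HB)).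
  apply Rabs_def2 in HC1. apply Rabs_def2 in HC2.
  destruct (Hsig t Htt) as [Hbt Hzt].
  assert (s1 < sigma t)%R.
  { destruct (Rle_lt_dec (sigma t) s1) as [Hle|]; [|assumption]. exfalso.
    destruct (Req_dec (sigma t) s1) as [E|]; [rewrite E in Hzt; lra|].
    pose proof (Hmono t Htt (sigma t) s1). lra. }
  assert (sigma t < s2)%R.
  { destruct (Rle_lt_dec s2 (sigma t)) as [Hle|]; [|assumption]. exfalso.
    destruct (Req_dec (sigma t) s2) as [E|]; [rewrite E in Hzt; lra|].
    pose proof (Hmono t Htt s2 (sigma t)). lra. }
  apply Rabs_def1; lra.
Qed.

(** * Level arms *)

(** Coordinates around the half-line of direction [e]: affine in [t] for fixed
    [s] and in [s] for fixed [t], so that derivatives along both families are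
    those of straight lines. *)
Definition ray (c e : C) (t s : R) : C := c + RtoC t * (e * (1 + Ci * RtoC s)).

(** The sector width [delta] is left free, to be chosen small enough that arms in
    different directions are disjoint. *)
Definition has_arm (phi : C -> C) (c e : C) : Prop :=
  exists delta0 : R, (0 < delta0)%R /\
    forall delta : R, (0 < delta <= delta0)%R ->
      exists (T : R) (sigma : R -> R), (0 < T)%R /\
        forall t : R, (0 < t < T)%R ->
          (Rabs (sigma t) <= delta)%R /\ continuity_pt sigma t /\
          Re (phi (ray c e t (sigma t))) = Re (phi c).

Lemma Cpow_near_1 (m : nat) (eps : R) : (0 < eps)%R ->
  exists d : R, (0 < d)%R /\ forall w : C, (Cmod (w - 1) < d)%R -> (Cmod (w ^ m - 1) < eps)%R.
Proof.
  revert eps. induction m as [|m IH]; intros eps Heps.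
  - exists 1%R. split; [lra|]. intros w _. simpl.
    replace (1 - 1) with (RtoC 0) by ring. now rewrite Cmod_0.
  - destruct (IH (eps / 4)%R) as [d [Hd H]]; [lra|].
    exists (Rmin d (Rmin 1 (eps / 4))). split; [repeat apply Rmin_glb_lt; lra|].
    intros w Hw.
    assert (H1 : (Cmod (w - 1) < d)%R) by (eapply Rlt_le_trans; [exact Hw|apply Rmin_l]).
    assert (H2 : (Cmod (w - 1) < 1)%R)
      by (eapply Rlt_le_trans; [exact Hw|]; eapply Rle_trans; [apply Rmin_r|apply Rmin_l]).
    assert (H3 : (Cmod (w - 1) < eps / 4)%R)
      by (eapply Rlt_le_trans; [exact Hw|]; eapply Rle_trans; apply Rmin_r).
    specialize (H w H1). rewrite Cpow_S.
    replace (w * w ^ m - 1) with ((w - 1) * (w ^ m - 1) + (w ^ m - 1) + (w - 1)) by ring.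
    eapply Rle_lt_trans; [apply Cmod_triangle|].
    eapply Rle_lt_trans; [apply Rplus_le_compat_r, Cmod_triangle|].
    rewrite Cmod_mult. pose proof (Cmod_ge_0 (w - 1)). pose proof (Cmod_ge_0 (w ^ m - 1)). nra.
Qed.

Lemma Cmod_ray (c e : C) (t s : R) :
  Cmod e = 1%R -> (0 < t)%R -> (Rabs s <= 1)%R -> (Cmod (ray c e t s - c) <= 2 * t)%R.
Proof.
  intros He Ht Hs. unfold ray.
  replace (c + RtoC t * (e * (1 + Ci * RtoC s)) - c)
    with (RtoC t * (e * (1 + Ci * RtoC s))) by ring.
  rewrite !Cmod_mult, He, Cmod_R, Rabs_pos_eq by lra.
  assert (Cmod (1 + Ci * RtoC s) <= 2)%R; [|nra].
  eapply Rle_trans; [apply Cmod_triangle|].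
  rewrite Cmod_1, Cmod_mult, Cmod_Ci, Cmod_R. lra.
Qed.

Lemma curve_derive_continuity_Re (p : R -> C) (t : R) (l : C) :
  is_curve_derive p t l -> continuity_pt (fun s => Re (p s)) t.
Proof.
  intros [H _]. apply continuity_pt_filterlim.
  apply (ex_derive_continuous (fun s => Re (p s))). now exists (Re l).
Qed.

Lemma curve_derive_ext (p q : R -> C) (t : R) (l : C) :
  (forall s, p s = q s) -> is_curve_derive p t l -> is_curve_derive q t l.
Proof.
  intros E [H1 H2]. split.
  - eapply is_derive_ext; [|exact H1]. intros s. exact (f_equal Re (E s)).
  - eapply is_derive_ext; [|exact H2]. intros s. exact (f_equal Im (E s)).
Qed.

Lemma ray_derive_s (phi : C -> C) (c e l : C) (t s : R) :
  is_cderive phi (ray c e t s) l ->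
  is_curve_derive (fun s => phi (ray c e t s)) s (l * (RtoC t * e * Ci)).
Proof.
  intros H.
  assert (E : forall s : R, c + RtoC t * e + RtoC s * (RtoC t * e * Ci) = ray c e t s)
    by (intros; unfold ray; ring).
  apply curve_derive_ext with (fun s => phi (c + RtoC t * e + RtoC s * (RtoC t * e * Ci))).
  - intros s'. now rewrite E.
  - apply curve_derive_line. now rewrite E.
Qed.

Lemma ray_derive_t (phi : C -> C) (c e l : C) (t s : R) :
  is_cderive phi (ray c e t s) l ->
  is_curve_derive (fun t => phi (ray c e t s)) t (l * (e * (1 + Ci * RtoC s))).
Proof. exact (curve_derive_line phi c (e * (1 + Ci * RtoC s)) t l). Qed.

(** Put [w = 1 + i * s].  By the leading term of [phi'], the derivative in [s]
    of [Re phi] on the rays is about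
    [t^n * n * Re (i * e^n * a_n * w^(n-1))], and [i * e^n * a_n] is a nonzero
    real number [beta].  After multiplication by [beta] it is at least
    [t^n * beta^2 / 2] for small [s] and [t], while the value at [s = 0] is
    [o(t^n)]: hence opposite signs at [s = - delta] and [s = delta]. *)
Lemma leading_term_arm (a : nat -> C) (c : C) (rho : R) (phi : C -> C) (n : nat) (e : C) :
  (0 < rho)%R -> sums_to a c rho phi -> (2 <= n)%nat ->
  (forall j, (1 <= j < n)%nat -> a j = 0) -> a n <> 0 ->
  Cmod e = 1%R -> Re (e ^ n * a n) = 0%R -> has_arm phi c e.
Proof.
  intros Hrho H Hn Ha HA He HRe.
  destruct n as [|m]; [lia|]. assert (Hm : (1 <= m)%nat) by lia.
  set (beta := (- Im (e ^ S m * a (S m)))%R).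
  assert (Hbeta : Ci * (e ^ S m * a (S m)) = RtoC beta).
  { unfold beta. destruct (e ^ S m * a (S m)) as [x y]. simpl in *. subst x.
    unfold Ci, Cmult, RtoC; simpl. f_equal; ring. }
  assert (Hb0 : (0 < Rabs beta)%R).
  { apply Rabs_pos_lt. intros E. rewrite E in Hbeta.
    assert (Hz : e ^ S m * a (S m) = 0).
    { replace (e ^ S m * a (S m)) with (- (Ci * (Ci * (e ^ S m * a (S m))))).
      - rewrite Hbeta. ring.
      - replace (- (Ci * (Ci * (e ^ S m * a (S m))))) with (- (Ci * Ci) * (e ^ S m * a (S m)))
          by ring.
        replace (Ci * Ci) with (- (1)); [ring|].
        unfold Ci, Cmult, Copp, RtoC; simpl. f_equal; ring. }
    revert Hz. apply Cmult_neq_0; [|exact HA]. apply Cpow_nz. intros E'.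
    rewrite E', Cmod_0 in He. lra. }
  destruct (sums_to_C_derive a c rho phi H) as [Hder Hsum'].
  assert (Hder0 : C_derive phi c = 0).
  { rewrite (sums_to_center _ c rho _ Hrho Hsum'). unfold coef_derive. rewrite Ha by lia. ring. }
  assert (H2m : (0 < 2 ^ m)%R) by (apply pow_lt; lra).
  (* The factor [2 ^ m] compensates [Cmod w ^ m], as [Cmod w <= 2]. *)
  set (eps := (Rabs beta / (4 * 2 ^ m))%R).
  assert (Heps : (0 < eps)%R) by (apply Rdiv_lt_0_compat; lra).
  destruct (sums_to_leading_term _ c rho _ m eps Hrho Hsum' Hm) as [d1 [Hd1 Hlead']].
  { intros j Hj. unfold coef_derive. rewrite Ha by lia. ring. }
  { exact Heps. }
  destruct (Cpow_near_1 m (/ 4)) as [d2 [Hd2 Hpow]]; [lra|].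
  exists (Rmin 1 (d2 / 2)). split; [apply Rmin_glb_lt; lra|].
  intros delta [Hdelta Hdelta'].
  assert (Hdelta1 : (delta <= 1)%R) by (eapply Rle_trans; [exact Hdelta'|apply Rmin_l]).
  assert (Hdelta2 : (delta <= d2 / 2)%R) by (eapply Rle_trans; [exact Hdelta'|apply Rmin_r]).
  (* Up to the factor [t ^ S m], the value at [s = 0] is then at most
     [Rabs beta * eps' = beta ^ 2 * delta / 4], half of the increment guaranteed
     between [s = 0] and [s = delta]. *)
  set (eps' := (Rabs beta * delta / 4)%R).
  assert (Heps' : (0 < eps')%R) by (unfold eps'; nra).
  destruct (sums_to_leading_term _ c rho _ (S m) eps' Hrho H) as [d3 [Hd3 Hlead]];
    [lia|exact Ha|exact Heps'|].
  (* [Rmin] is halved because the rays at parameter [t] reach up to [2 * t]. *)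
  set (T := (Rmin rho (Rmin d1 d3) / 2)%R).
  assert (HT : (0 < T)%R) by (unfold T; assert (0 < Rmin rho (Rmin d1 d3))%R
    by (repeat apply Rmin_glb_lt; lra); lra).
  assert (HTray : forall t s, (0 < t < T)%R -> (- delta <= s <= delta)%R ->
    disk c rho (ray c e t s) /\ disk c d1 (ray c e t s) /\ disk c d3 (ray c e t s)).
  { intros t s Ht Hs.
    assert (Hray : (Cmod (ray c e t s - c) <= 2 * t)%R).
    { apply Cmod_ray; [exact He|lra|]. apply Rabs_le. lra. }
    assert (Hlt : (Cmod (ray c e t s - c) < Rmin rho (Rmin d1 d3))%R) by (unfold T in Ht; lra).
    unfold disk. repeat split; (eapply Rlt_le_trans; [exact Hlt|]).
    - apply Rmin_l.
    - eapply Rle_trans; [apply Rmin_r|apply Rmin_l].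
    - eapply Rle_trans; apply Rmin_r. }
  set (U := fun t s : R => (beta * (Re (phi (ray c e t s)) - Re (phi c)))%R).
  set (D := fun t s : R => (beta * Re (C_derive phi (ray c e t s) * (RtoC t * e * Ci)))%R).
  assert (HUD : forall t s, (0 < t < T)%R -> (- delta <= s <= delta)%R ->
    is_derive (U t) s (D t s)).
  { intros t s Ht Hs. destruct (HTray t s Ht Hs) as [Hin _].
    destruct (ray_derive_s phi c e _ t s (Hder _ Hin)) as [HR _].
    unfold U, D. apply (is_derive_scal _ s beta).
    evar_last.
    - apply (@is_derive_minus R_AbsRing R_NormedModule); [exact HR|apply is_derive_const].
    - unfold minus, plus, opp, zero; simpl. ring. }
  assert (HD : forall t s, (0 < t < T)%R -> (- delta <= s <= delta)%R ->
    (t ^ S m * beta ^ 2 / 2 <= D t s)%R).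
  { intros t s Ht Hs. destruct (HTray t s Ht Hs) as [_ [Hin _]].
    specialize (Hlead' _ Hin). unfold D. rewrite Hder0 in Hlead'.
    set (w := 1 + Ci * RtoC s).
    assert (Hw : ray c e t s - c = RtoC t * (e * w)) by (unfold ray, w; ring).
    rewrite Hw in Hlead'. unfold coef_derive in Hlead'.
    set (z := ray c e t s) in *.
    set (E := C_derive phi z - 0 - (RtoC t * (e * w)) ^ m * (INR (S m) * a (S m))) in *.
    assert (Hval : C_derive phi z * (RtoC t * e * Ci)
      = RtoC (t ^ S m * INR (S m) * beta)%R * w ^ m + E * (RtoC t * e * Ci)).
    { rewrite !RtoC_mult, RtoC_pow, <- Hbeta. unfold E.
      rewrite !Cpow_mult_l, !Cpow_S. ring. }
    rewrite Hval.
    assert (HE : (Cmod (E * (RtoC t * e * Ci)) <= t ^ S m * Rabs beta / 4)%R).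
    { rewrite !Cmod_mult, He, Cmod_Ci, Cmod_R, (Rabs_pos_eq t) by lra.
      rewrite !Rmult_1_r.
      assert (HE1 : (Cmod E <= eps * (t ^ m * 2 ^ m))%R).
      { eapply Rle_trans; [exact Hlead'|]. apply Rmult_le_compat_l; [lra|].
        rewrite <- Rpow_mult_distr. apply pow_incr. split; [apply Cmod_ge_0|].
        rewrite <- Hw. unfold z. rewrite Rmult_comm. apply Cmod_ray; [exact He|lra|].
        apply Rabs_le; lra. }
      replace (t ^ S m * Rabs beta / 4)%R with (eps * (t ^ m * 2 ^ m) * t)%R.
      - apply Rmult_le_compat_r; [lra|exact HE1].
      - unfold eps. simpl. field. lra. }
    assert (Hwm : (3 / 4 <= Re (w ^ m))%R).
    { assert (Hw1 : (Cmod (w - 1) < d2)%R).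
      { replace (w - 1) with (Ci * RtoC s) by (unfold w; ring).
        rewrite Cmod_mult, Cmod_Ci, Cmod_R.
        assert (Rabs s <= delta)%R by (apply Rabs_le; lra). lra. }
      specialize (Hpow w Hw1).
      pose proof (re_le_Cmod (w ^ m - 1)) as Hre.
      replace (Re (w ^ m - 1)) with (Re (w ^ m) - 1)%R in Hre
        by (destruct (w ^ m); simpl; ring).
      pose proof (Rle_abs (- (Re (w ^ m) - 1))) as Hab. rewrite Rabs_Ropp in Hab. lra. }
    pose proof (re_le_Cmod (E * (RtoC t * e * Ci))) as HreE.
    set (r := Re (E * (RtoC t * e * Ci))) in *.
    replace (Re (RtoC (t ^ S m * INR (S m) * beta)%R * w ^ m + E * (RtoC t * e * Ci)))
      with (t ^ S m * INR (S m) * beta * Re (w ^ m) + r)%R.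
    2:{ unfold r. destruct (w ^ m), (E * (RtoC t * e * Ci)). simpl. ring. }
    assert (Hr : (- (t ^ S m * beta ^ 2 / 4) <= beta * r)%R).
    { assert (Hbr : (Rabs (beta * r) <= t ^ S m * beta ^ 2 / 4)%R).
      { rewrite Rabs_mult, <- (pow2_abs beta).
        replace (t ^ S m * Rabs beta ^ 2 / 4)%R
          with (Rabs beta * (t ^ S m * Rabs beta / 4))%R by field.
        apply Rmult_le_compat_l; lra. }
      apply Rabs_le_between in Hbr. lra. }
    assert (Htm : (0 < t ^ S m)%R) by (apply pow_lt; lra).
    assert (Hb2 : (0 <= t ^ S m * beta ^ 2)%R)
      by (apply Rmult_le_pos; [lra|apply pow2_ge_0]).
    assert (Hn1 : (1 <= INR (S m))%R).
    { rewrite S_INR. pose proof (pos_INR m). lra. }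
    replace (beta * (t ^ S m * INR (S m) * beta * Re (w ^ m) + r))%R
      with ((t ^ S m * beta ^ 2) * (INR (S m) * Re (w ^ m)) + beta * r)%R by ring.
    assert (3 / 4 <= INR (S m) * Re (w ^ m))%R by nra.
    nra. }
  assert (Hincr : forall t s s', (0 < t < T)%R -> (- delta <= s)%R -> (s < s')%R ->
    (s' <= delta)%R -> (t ^ S m * beta ^ 2 / 2 * (s' - s) <= U t s' - U t s)%R).
  { intros t s s' Ht Hs Hss Hs'.
    destruct (MVT_gen (U t) s s' (D t)) as [x [Hx Heq]].
    - rewrite Rmin_left, Rmax_right by lra. intros x Hx. apply HUD; [exact Ht|lra].
    - rewrite Rmin_left, Rmax_right by lra. intros x Hx. apply continuity_pt_filterlim.
      apply (ex_derive_continuous (U t)). exists (D t x). apply HUD; [exact Ht|lra].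
    - rewrite Rmin_left, Rmax_right in Hx by lra. rewrite Heq.
      apply Rmult_le_compat_r; [lra|]. apply HD; [exact Ht|lra]. }
  assert (Hpos : forall t, (0 < t)%R -> (0 < t ^ S m * beta ^ 2)%R).
  { intros t Ht. rewrite <- pow2_abs. apply Rmult_lt_0_compat; apply pow_lt; assumption. }
  assert (Hmid : forall t, (0 < t < T)%R -> (Rabs (U t 0) <= t ^ S m * beta ^ 2 * delta / 4)%R).
  { intros t Ht. destruct (HTray t 0%R Ht) as [_ [_ Hin]]; [lra|].
    specialize (Hlead _ Hin). unfold U.
    assert (Hw : ray c e t 0 - c = RtoC t * e) by (unfold ray; ring).
    rewrite Hw in Hlead.
    pose proof (re_le_Cmod (phi (ray c e t 0) - phi c - (RtoC t * e) ^ S m * a (S m))) as Hre.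
    replace ((RtoC t * e) ^ S m * a (S m)) with (RtoC (t ^ S m) * (e ^ S m * a (S m))) in Hre
      by (rewrite RtoC_pow, Cpow_mult_l; ring).
    replace (Re (phi (ray c e t 0) - phi c - RtoC (t ^ S m) * (e ^ S m * a (S m))))
      with (Re (phi (ray c e t 0)) - Re (phi c))%R in Hre.
    2:{ revert HRe. destruct (e ^ S m * a (S m)) as [x y], (phi (ray c e t 0)), (phi c).
        simpl. intros ->. ring. }
    replace (RtoC (t ^ S m) * (e ^ S m * a (S m))) with ((RtoC t * e) ^ S m * a (S m)) in Hre
      by (rewrite RtoC_pow, Cpow_mult_l; ring).
    rewrite Cmod_mult, He, Rmult_1_r, Cmod_R, (Rabs_pos_eq t) in Hlead by lra.
    rewrite Rabs_mult, <- (pow2_abs beta).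
    replace (t ^ S m * Rabs beta ^ 2 * delta / 4)%R with (Rabs beta * (eps' * t ^ S m))%R
      by (unfold eps'; field).
    apply Rmult_le_compat_l; lra. }
  destruct (monotone_zero_curve U delta T Hdelta) as [sigma Hsigma].
  - intros t Ht s s' Hs Hss Hs'. pose proof (Hincr t s s' Ht Hs Hss Hs').
    pose proof (Hpos t (proj1 Ht)). nra.
  - intros t Ht s Hs. apply continuity_pt_filterlim.
    apply (ex_derive_continuous (U t)). exists (D t s). now apply HUD.
  - intros t Ht. specialize (Hmid t Ht). apply Rabs_le_between in Hmid.
    pose proof (Hpos t (proj1 Ht)).
    pose proof (Hincr t (- delta)%R 0%R Ht ltac:(lra) ltac:(lra) ltac:(lra)).
    pose proof (Hincr t 0%R delta Ht ltac:(lra) ltac:(lra) ltac:(lra)).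
    assert (0 < t ^ S m * beta ^ 2 * delta)%R by nra. lra.
  - intros s Hs t Ht. destruct (HTray t s Ht Hs) as [Hin _].
    apply (continuity_pt_scal (fun t => Re (phi (ray c e t s)) - Re (phi c))%R beta).
    apply continuity_pt_minus.
    + exact (curve_derive_continuity_Re _ _ _ (ray_derive_t phi c e _ t s (Hder _ Hin))).
    + apply continuity_pt_const. intros x y. reflexivity.
  - exists T, sigma. split; [exact HT|]. intros t Ht.
    destruct (Hsigma t Ht) as [Hs1 [Hs2 Hs3]]. repeat split; [exact Hs1|exact Hs3|].
    unfold U in Hs2. apply Rmult_integral in Hs2.
    destruct Hs2 as [E|E]; [|lra]. rewrite E, Rabs_R0 in Hb0. lra.
Qed.

(** * Polar form *)

Definition cis (x : R) : C := (cos x, sin x).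

Lemma cis_plus (x y : R) : cis (x + y) = cis x * cis y.
Proof.
  unfold cis, Cmult; simpl. rewrite cos_plus, sin_plus. f_equal; ring.
Qed.

Lemma cis_pow (x : R) (n : nat) : cis x ^ n = cis (INR n * x).
Proof.
  induction n as [|n IH].
  - simpl. unfold cis. rewrite Rmult_0_l, cos_0, sin_0. reflexivity.
  - rewrite Cpow_S, IH, <- cis_plus. f_equal. rewrite S_INR. ring.
Qed.

Lemma Cmod_cis (x : R) : Cmod (cis x) = 1%R.
Proof.
  unfold Cmod, cis; simpl. rewrite <- sqrt_1 at 3. f_equal.
  pose proof (sin2_cos2 x) as H. unfold Rsqr in H. lra.
Qed.

Lemma cis_neq_1 (x : R) : (0 < x < 2 * PI)%R -> cis x <> 1.
Proof.
  intros Hx E. apply (f_equal fst) in E. simpl in E.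
  replace x with (2 * (x / 2))%R in E by field. rewrite cos_2a_sin in E.
  assert (0 < sin (x / 2))%R by (apply sin_gt_0; lra). nra.
Qed.

Lemma cis_exists (u : C) : Cmod u = 1%R -> exists x : R, u = cis x.
Proof.
  intros H. pose proof (Cmod2_alt u) as E. rewrite H in E.
  destruct u as [a b]. simpl in E.
  assert (Ha : (-1 <= a <= 1)%R) by nra.
  assert (Hs : sin (acos a) = Rabs b).
  { rewrite sin_acos by exact Ha. rewrite <- sqrt_Rsqr_abs. f_equal. unfold Rsqr. lra. }
  destruct (Rle_lt_dec 0 b) as [Hb|Hb].
  - exists (acos a). unfold cis. rewrite cos_acos, Hs, Rabs_pos_eq by assumption. reflexivity.
  - exists (- acos a)%R. unfold cis. rewrite cos_neg, sin_neg, cos_acos, Hs by exact Ha.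
    rewrite Rabs_left by exact Hb. f_equal. ring.
Qed.

Lemma Cpolar (z : C) : exists x : R, z = RtoC (Cmod z) * cis x.
Proof.
  destruct (classic (z = 0)) as [->|Hz].
  - exists 0%R. rewrite Cmod_0. ring.
  - assert (Hm : RtoC (Cmod z) <> 0).
    { intros E. apply RtoC_inj in E. now apply Cmod_eq_0 in E. }
    destruct (cis_exists (z / RtoC (Cmod z))) as [x Hx].
    + rewrite Cmod_div by exact Hm. rewrite Cmod_R, Rabs_pos_eq by apply Cmod_ge_0.
      field. intros E. apply Hm. now rewrite E.
    + exists x. rewrite <- Hx. field. exact Hm.
Qed.

(** * Three disjoint arms *)

(** If [a n] is the first nonzero coefficient after [a 0], there are [2 * n] unit
    directions [e] with [Re (e^n * a n) = 0], spaced by [PI / n]; as [n >= 2],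
    three consecutive ones are distinct.  If there is none, [phi] is constant
    and every direction is an arm. *)
Lemma three_arms (a : nat -> C) (c : C) (rho : R) (phi : C -> C) :
  (0 < rho)%R -> sums_to a c rho phi -> a 1%nat = 0 ->
  exists e1 e2 e3 : C,
    (Cmod e1 = 1 /\ Cmod e2 = 1 /\ Cmod e3 = 1)%R /\
    (e1 <> e2 /\ e1 <> e3 /\ e2 <> e3) /\
    (has_arm phi c e1 /\ has_arm phi c e2 /\ has_arm phi c e3).
Proof.
  intros Hrho H Ha1.
  assert (Hdir : exists b x : R, (0 < x)%R /\ (2 * x < 2 * PI)%R /\
    forall j : nat, (j <= 2)%nat -> has_arm phi c (cis (b + INR j * x))).
  { destruct (classic (exists n, (1 <= n)%nat /\ a n <> 0)) as [Hex|Hno].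
    - destruct (dec_inh_nat_subset_has_unique_least_element
                  (fun n => (1 <= n)%nat /\ a n <> 0)) as [n [[[Hn HA] Hleast] _]].
      { intros n. apply classic. }
      { exact Hex. }
      assert (Hn2 : (2 <= n)%nat).
      { destruct (Nat.eq_dec n 1) as [->|]; [contradiction|lia]. }
      destruct (Cpolar (a n)) as [theta Htheta].
      pose proof PI_RGT_0 as HPI.
      assert (HnR : (2 <= INR n)%R) by (apply le_INR in Hn2; exact Hn2).
      assert (Hdiv : (PI / INR n <= PI / 2)%R).
      { apply Rmult_le_compat_l; [lra|]. apply Rinv_le_contravar; lra. }
      exists ((PI / 2 - theta) / INR n)%R, (PI / INR n)%R.
      split; [apply Rdiv_lt_0_compat; lra|]. split; [lra|].
      intros j Hj. apply (leading_term_arm a c rho phi n); try assumption.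
      + intros i Hi. apply NNPP. intros Hai. specialize (Hleast i (conj (proj1 Hi) Hai)). lia.
      + apply Cmod_cis.
      + rewrite cis_pow, Htheta.
        replace (INR n * ((PI / 2 - theta) / INR n + INR j * (PI / INR n)))%R
          with (PI / 2 + INR j * PI - theta)%R by (field; lra).
        rewrite (Cmult_comm (RtoC _)), Cmult_assoc, <- cis_plus.
        replace (PI / 2 + INR j * PI - theta + theta)%R with (INR j * PI + PI / 2)%R by ring.
        unfold cis, Re. simpl.
        rewrite cos_plus, cos_PI2, sin_PI2.
        assert (Hsin : sin (INR j * PI) = 0%R).
        { destruct j as [|[|[|j]]]; [| | |lia]; simpl.
          - now rewrite Rmult_0_l, sin_0.
          - now rewrite Rmult_1_l, sin_PI.
          - apply sin_2PI. }
        rewrite Hsin. ring.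
    - assert (Hconst : forall j, (1 <= j)%nat -> a j = 0).
      { intros j Hj. apply NNPP. intros Hj'. apply Hno. now exists j. }
      exists 0%R, (PI / 2)%R. pose proof PI_RGT_0. repeat split; try lra.
      intros j _. exists 1%R. split; [lra|]. intros delta Hdelta.
      exists rho, (fun _ => 0%R). split; [exact Hrho|]. intros t Ht. repeat split.
      + rewrite Rabs_R0. lra.
      + apply continuity_pt_const. intros x y. reflexivity.
      + f_equal. apply (sums_to_constant a c rho phi _ H Hconst).
        unfold disk, ray. replace (c + _ - c) with (RtoC t * cis (0 + INR j * (PI / 2))) by ring.
        rewrite Cmod_mult, Cmod_cis, Cmod_R, Rabs_pos_eq; lra. }
  destruct Hdir as [b [x [Hx0 [Hx1 Harm]]]].
  assert (Hneq : forall y z : R, (0 < z < 2 * PI)%R -> cis y <> cis (y + z)).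
  { intros y z Hz E. rewrite cis_plus in E. apply (cis_neq_1 z Hz).
    assert (Hy : cis y <> 0).
    { intros E0. pose proof (Cmod_cis y) as Hm. rewrite E0, Cmod_0 in Hm. lra. }
    replace (cis z) with (cis y * cis z / cis y) by (field; exact Hy).
    rewrite <- E. field. exact Hy. }
  exists (cis (b + INR 0 * x)), (cis (b + INR 1 * x)), (cis (b + INR 2 * x)).
  split; [repeat split; apply Cmod_cis|]. split.
  - simpl. repeat split.
    + replace (b + 1 * x)%R with (b + 0 * x + x)%R by ring. apply Hneq. lra.
    + replace (b + (1 + 1) * x)%R with (b + 0 * x + 2 * x)%R by ring. apply Hneq. lra.
    + replace (b + (1 + 1) * x)%R with (b + 1 * x + x)%R by ring. apply Hneq. lra.
  - repeat split; apply Harm; lia.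
Qed.

(** If two such points coincide, [e / e'] is a positive multiple of
    [(1 + i * s') / (1 + i * s)], hence close in argument to the positive
    real axis, to which a unimodular number other than 1 keeps a fixed angle. *)
Lemma rays_disjoint (c e e' : C) : Cmod e = 1%R -> Cmod e' = 1%R -> e <> e' ->
  exists delta : R, (0 < delta)%R /\
    forall t t' s s' : R, (0 < t)%R -> (0 < t')%R ->
      (Rabs s <= delta)%R -> (Rabs s' <= delta)%R -> ray c e t s <> ray c e' t' s'.
Proof.
  intros He He' Hne.
  assert (He0 : e' <> 0) by (intros E; rewrite E, Cmod_0 in He'; lra).
  set (u := e / e').
  assert (Hu : Cmod u = 1%R) by (unfold u; rewrite Cmod_div, He, He' by exact He0; field).
  pose proof (Cmod2_alt u) as Hu2. rewrite Hu in Hu2.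
  assert (Hu1 : u <> 1).
  { intros E. apply Hne. replace e with (u * e') by (unfold u; field; exact He0).
    rewrite E. ring. }
  assert (Heq : forall t t' s s', ray c e t s = ray c e' t' s' ->
    (t * (Re u - s * Im u) = t')%R /\ (t * (Im u + s * Re u) = t' * s')%R).
  { intros t t' s s' E.
    assert (E' : RtoC t * (u * (1 + Ci * RtoC s)) = RtoC t' * (1 + Ci * RtoC s')).
    { replace (RtoC t * (u * (1 + Ci * RtoC s))) with ((ray c e t s - c) / e')
        by (unfold ray, u; field; exact He0).
      rewrite E. unfold ray. field. exact He0. }
    destruct u as [p q].
    pose proof (f_equal fst E') as E1. pose proof (f_equal snd E') as E2.
    simpl in *. split; lra. }
  clearbody u. destruct u as [p q]. simpl in *.
  destruct (Req_dec q 0) as [Hq|Hq].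
  - exists 1%R. split; [lra|]. intros t t' s s' Ht Ht' Hs Hs' E.
    destruct (Heq _ _ _ _ E) as [E1 _]. subst q.
    destruct (Req_dec p 1) as [->|]; [now apply Hu1|].
    assert (p = -1)%R by nra. subst p. lra.
  - apply Rabs_pos_lt in Hq.
    exists (Rmin 1 (Rabs q / 8)). split; [apply Rmin_glb_lt; lra|].
    intros t t' s s' Ht Ht' Hs Hs' E.
    destruct (Heq _ _ _ _ E) as [E1 E2]. rewrite <- E1 in E2.
    assert (E3 : (q + s * p = (p - s * q) * s')%R) by (apply (Rmult_eq_reg_l t); lra).
    assert (Hs1 : (Rabs s <= 1)%R) by (eapply Rle_trans; [exact Hs|apply Rmin_l]).
    assert (Hs2 : (Rabs s <= Rabs q / 8)%R) by (eapply Rle_trans; [exact Hs|apply Rmin_r]).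
    assert (Hs3 : (Rabs s' <= Rabs q / 8)%R) by (eapply Rle_trans; [exact Hs'|apply Rmin_r]).
    assert (Hp1 : (Rabs p <= 1)%R) by (apply Rabs_le; nra).
    assert (Hq1 : (Rabs q <= 1)%R) by (apply Rabs_le; nra).
    assert (E4 : q = (p * s' - s * q * s' - s * p)%R) by lra.
    assert (Hbound : (Rabs q <= Rabs p * Rabs s' + Rabs s * Rabs q * Rabs s' + Rabs s * Rabs p)%R).
    { rewrite E4 at 1. unfold Rminus.
      eapply Rle_trans; [apply Rabs_triang|].
      eapply Rle_trans; [apply Rplus_le_compat_r, Rabs_triang|].
      rewrite !Rabs_Ropp, !Rabs_mult. lra. }
    pose proof (Rabs_pos p). pose proof (Rabs_pos s). pose proof (Rabs_pos s').
    assert (Rabs p * Rabs s' <= Rabs q / 8)%R by nra.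
    assert (Rabs s * Rabs p <= Rabs q / 8)%R by nra.
    assert (Rabs s * Rabs q <= 1)%R by nra.
    assert (Rabs s * Rabs q * Rabs s' <= Rabs q / 8)%R by nra.
    lra.
Qed.

(** * Values along arms *)

Lemma ray_curve_continuous (c e : C) (sigma : R -> R) (t0 eps : R) :
  Cmod e = 1%R -> continuity_pt sigma t0 -> (0 < eps)%R ->
  exists d : R, (0 < d)%R /\ forall t, (Rabs (t - t0) < d)%R ->
    (Cmod (ray c e t (sigma t) - ray c e t0 (sigma t0)) < eps)%R.
Proof.
  intros He Hs Heps.
  assert (Hc : continuity_pt (fun t => t * sigma t)%R t0)
    by (apply (continuity_pt_mult (fun t => t) sigma); [apply continuity_pt_id|exact Hs]).
  destruct (Hc (eps / 2)%R) as [d [Hd H]]; [lra|].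
  exists (Rmin d (eps / 2)). split; [apply Rmin_glb_lt; lra|].
  intros t Ht.
  assert (H1 : (Rabs (t - t0) < d)%R) by (eapply Rlt_le_trans; [exact Ht|apply Rmin_l]).
  assert (H2 : (Rabs (t - t0) < eps / 2)%R) by (eapply Rlt_le_trans; [exact Ht|apply Rmin_r]).
  assert (H3 : (Rabs (t * sigma t - t0 * sigma t0) < eps / 2)%R).
  { destruct (Req_dec t0 t) as [<-|Hne].
    - replace (t0 * sigma t0 - t0 * sigma t0)%R with 0%R by ring. rewrite Rabs_R0. lra.
    - apply (H t). repeat split; [exact Hne|exact H1]. }
  replace (ray c e t (sigma t) - ray c e t0 (sigma t0))
    with (e * (RtoC (t - t0) + Ci * RtoC (t * sigma t - t0 * sigma t0))).
  2:{ unfold ray. rewrite !RtoC_minus, !RtoC_mult. ring. }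
  rewrite Cmod_mult, He, Rmult_1_l.
  eapply Rle_lt_trans; [apply Cmod_triangle|].
  rewrite Cmod_mult, Cmod_Ci, !Cmod_R. lra.
Qed.

Lemma value_below (p : R -> R) (T m : R) :
  (0 < T)%R -> (forall t, (0 < t < T)%R -> continuity_pt p t) ->
  (forall eps, 0 < eps -> exists d, 0 < d /\ forall t, 0 < t < d -> p t < eps)%R ->
  forall b, (0 < b < T)%R -> (0 < m <= p b)%R -> exists t, (0 < t < T)%R /\ p t = m.
Proof.
  intros HT Hc Hlim b Hb Hm.
  destruct (Req_dec (p b) m) as [E|Hne]; [now exists b|].
  destruct (Hlim m) as [d [Hd Hlow]]; [lra|].
  set (x := (Rmin d b / 2)%R).
  assert (Hx : (0 < Rmin d b)%R) by (apply Rmin_glb_lt; lra).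
  pose proof (Rmin_l d b). pose proof (Rmin_r d b).
  assert (Hpx : (p x < m)%R) by (apply Hlow; unfold x; lra).
  destruct (IVT_interv (fun t => p t - m)%R x b) as [t [Ht E]].
  - intros t Ht. apply continuity_pt_minus; [apply Hc; unfold x in Ht; lra|].
    apply continuity_pt_const. intros y z. reflexivity.
  - unfold x; lra.
  - lra.
  - lra.
  - exists t. unfold x in Ht. split; lra.
Qed.

Lemma common_value (p q : R -> R) (T S : R) :
  (0 < T)%R -> (0 < S)%R ->
  (forall t, (0 < t < T)%R -> continuity_pt p t /\ (0 < p t)%R) ->
  (forall t, (0 < t < S)%R -> continuity_pt q t /\ (0 < q t)%R) ->
  (forall eps, 0 < eps -> exists d, 0 < d /\ forall t, 0 < t < d -> p t < eps)%R ->
  (forall eps, 0 < eps -> exists d, 0 < d /\ forall t, 0 < t < d -> q t < eps)%R ->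
  exists t s, (0 < t < T)%R /\ (0 < s < S)%R /\ p t = q s.
Proof.
  intros HT HS Hp Hq Hpl Hql.
  assert (HbT : (0 < T / 2 < T)%R) by lra. assert (HbS : (0 < S / 2 < S)%R) by lra.
  destruct (Rle_lt_dec (p (T / 2)%R) (q (S / 2)%R)) as [Hle|Hlt].
  - destruct (value_below q S (p (T / 2)%R) HS (fun t Ht => proj1 (Hq t Ht)) Hql (S / 2)%R HbS)
      as [s [Hs E]]; [split; [apply Hp; lra|exact Hle]|].
    exists (T / 2)%R, s. auto.
  - destruct (value_below p T (q (S / 2)%R) HT (fun t Ht => proj1 (Hp t Ht)) Hpl (T / 2)%R HbT)
      as [t [Ht E]]; [split; [apply Hq; lra|lra]|].
    exists t, (S / 2)%R. auto.
Qed.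

Lemma constant_sign (p : R -> R) (T : R) :
  (0 < T)%R -> (forall t, (0 < t < T)%R -> continuity_pt p t /\ p t <> 0%R) ->
  exists eta : R, (eta = 1 \/ eta = -1)%R /\ forall t, (0 < t < T)%R -> (0 < eta * p t)%R.
Proof.
  intros HT H.
  (* Stated with the sign [eta] so as to exclude both directions of change. *)
  assert (Hno : forall eta x y, (eta = 1 \/ eta = -1)%R -> (0 < x)%R -> (x < y)%R -> (y < T)%R ->
    ~ (eta * p x < 0 /\ 0 < eta * p y)%R).
  { intros eta x y Heta Hx Hxy Hy [H1 H2].
    destruct (IVT_interv (fun t => eta * p t)%R x y) as [t [Ht E]]; try assumption.
    - intros t Ht. apply (continuity_pt_scal p eta). apply H. lra.
    - destruct (H t) as [_ H0]; [lra|]. apply H0. destruct Heta; subst eta; lra. }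
  destruct (H (T / 2)%R) as [_ Hmid]; [lra|].
  assert (Hs : exists eta, (eta = 1 \/ eta = -1)%R /\ (0 < eta * p (T / 2))%R).
  { destruct (Rlt_le_dec 0 (p (T / 2)%R)).
    - exists 1%R. split; [now left|lra].
    - exists (-1)%R. split; [now right|]. lra. }
  destruct Hs as [eta [Heta Hs]]. exists eta. split; [exact Heta|].
  intros t Ht. destruct (Rlt_le_dec 0 (eta * p t)) as [|Hle]; [assumption|exfalso].
  assert (Hlt : (eta * p t < 0)%R).
  { destruct (H t Ht) as [_ H0]. destruct Heta; subst eta; lra. }
  destruct (Rtotal_order t (T / 2)) as [Hc|[Hc|Hc]].
  - apply (Hno eta t (T / 2)%R); try assumption; lra.
  - subst t. lra.
  - apply (Hno (- eta)%R (T / 2)%R t); try lra.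
Qed.

(** * Lewy's theorem *)

Lemma sums_to_shrink (a : nat -> C) (c : C) (rho rho' : R) (k : C -> C) :
  (rho' <= rho)%R -> sums_to a c rho k -> sums_to a c rho' k.
Proof. intros Hle H z Hz. apply H. unfold disk in *. lra. Qed.

Lemma sums_to_combine (a b : nat -> C) (c : C) (rho : R) (h g : C -> C) (x y : C) :
  sums_to a c rho h -> sums_to b c rho g ->
  sums_to (fun n => x * a n + y * b n) c rho (fun z => x * h z + y * g z).
Proof.
  intros Hh Hg z Hz.
  eapply is_series_ext;
    [|exact (is_series_plus _ _ _ _ (is_series_scal x _ _ (Hh z Hz)) (is_series_scal y _ _ (Hg z Hz)))].
  intros n.
  change (x * ((z - c) ^ n * a n) + y * ((z - c) ^ n * b n) = (z - c) ^ n * (x * a n + y * b n)).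
  ring.
Qed.

(** With [p = r * cis x] and [q = r * cis y], the choice
    [kappa = cis ((y - x + PI) / 2)] makes the arguments of the two terms differ
    by [PI]. *)
Lemma unimodular_annihilator (p q : C) : Cmod p = Cmod q ->
  exists kappa : C, Cmod kappa = 1%R /\ kappa * p + Cconj kappa * q = 0.
Proof.
  intros Hpq.
  destruct (Cpolar p) as [x Hx], (Cpolar q) as [y Hy].
  exists (cis ((y - x + PI) / 2)). split; [apply Cmod_cis|].
  assert (Hconj : forall r, Cconj (cis r) = cis (- r)).
  { intros r. unfold cis, Cconj; simpl. now rewrite cos_neg, sin_neg. }
  rewrite Hconj, Hx, Hy, <- Hpq.
  replace (cis ((y - x + PI) / 2) * (RtoC (Cmod p) * cis x)
           + cis (- ((y - x + PI) / 2)) * (RtoC (Cmod p) * cis y))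
    with (RtoC (Cmod p) * (cis ((y - x + PI) / 2) * cis x + cis (- ((y - x + PI) / 2)) * cis y))
    by ring.
  rewrite <- !cis_plus.
  replace ((y - x + PI) / 2 + x)%R with (- ((y - x + PI) / 2) + y + PI)%R by field.
  set (w := (- ((y - x + PI) / 2) + y)%R). rewrite cis_plus.
  replace (cis PI) with (- (1)).
  - ring.
  - unfold cis. rewrite cos_PI, sin_PI. unfold Copp, RtoC; simpl. f_equal; ring.
Qed.

(** If the moduli of [h'(c)] and [g'(c)] were equal, [f] would map three disjoint
    arms of a level set of [Re (kappa * f)], all ending at [c], injectively into
    a line; but [f c] has only two sides in this line. *)
Lemma lewy_jacobian_neq_0 (h g : C -> C) (c : C) (eps : R) :
  analytic_at h c -> analytic_at g c -> (0 < eps)%R ->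
  (forall w1 w2, disk c eps w1 -> disk c eps w2 ->
     harmonic_map h g w1 = harmonic_map h g w2 -> w1 = w2) ->
  jacobian h g c <> 0%R.
Proof.
  intros [a [rho1 [Hrho1 Ha]]] [b [rho2 [Hrho2 Hb]]] Heps Hinj HJ.
  apply sums_to_pseries in Ha. apply sums_to_pseries in Hb.
  set (rho := Rmin rho1 rho2).
  assert (Hrho : (0 < rho)%R) by (now apply Rmin_glb_lt).
  apply (sums_to_shrink _ _ _ rho) in Ha; [|apply Rmin_l].
  apply (sums_to_shrink _ _ _ rho) in Hb; [|apply Rmin_r].
  destruct (sums_to_C_derive _ _ _ _ Ha) as [Hh' Hsh'].
  destruct (sums_to_C_derive _ _ _ _ Hb) as [Hg' Hsg'].
  assert (Hmods : Cmod (C_derive h c) = Cmod (C_derive g c)).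
  { unfold jacobian in HJ. pose proof (Cmod_ge_0 (C_derive h c)).
    pose proof (Cmod_ge_0 (C_derive g c)). nra. }
  destruct (unimodular_annihilator _ _ Hmods) as [kappa [Hkappa Hann]].
  set (phi := fun z => kappa * h z + Cconj kappa * g z).
  assert (Hphi : sums_to (fun n => kappa * a n + Cconj kappa * b n) c rho phi)
    by now apply sums_to_combine.
  assert (Hphi1 : kappa * a 1%nat + Cconj kappa * b 1%nat = 0).
  { rewrite (sums_to_center _ c rho _ Hrho Hsh'), (sums_to_center _ c rho _ Hrho Hsg') in Hann.
    unfold coef_derive in Hann. rewrite <- Hann. simpl. ring. }
  set (f := harmonic_map h g) in *.
  assert (HRe : forall z, Re (kappa * f z) = Re (phi z)).
  { intros z. unfold f, phi, harmonic_map.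
    destruct kappa, (h z), (g z). simpl. ring. }
  set (v := fun z => Im (kappa * (f z - f c))).
  assert (Hv : forall z w, (Rabs (v z - v w) <= Cmod (f z - f w))%R).
  { intros z w. unfold v.
    replace (Im (kappa * (f z - f c)) - Im (kappa * (f w - f c)))%R
      with (Im (kappa * (f z - f w))).
    - eapply Rle_trans; [apply im_le_Cmod|]. rewrite Cmod_mult, Hkappa. lra.
    - destruct kappa, (f z), (f c), (f w). simpl. ring. }
  assert (Hvc : v c = 0%R).
  { unfold v. replace (kappa * (f c - f c)) with (RtoC 0) by ring. reflexivity. }
  assert (Hsame : forall z w, Re (phi z) = Re (phi c) -> Re (phi w) = Re (phi c) ->
    v z = v w -> f z = f w).
  { intros z w Hz Hw Hzw. rewrite <- !HRe in Hz, Hw.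
    assert (E : kappa * f z = kappa * f w).
    { apply injective_projections; [exact (eq_trans Hz (eq_sym Hw))|].
      unfold v in Hzw. revert Hzw. destruct kappa, (f z), (f c), (f w). simpl. lra. }
    assert (Hk0 : kappa <> 0) by (intros E0; rewrite E0, Cmod_0 in Hkappa; lra).
    replace (f z) with (kappa * f z / kappa) by (field; exact Hk0).
    rewrite E. field. exact Hk0. }
  assert (Hlip : forall z, disk c rho z -> exists d L, (0 < d)%R /\ (0 < L)%R /\
    forall w, disk z d w -> (Rabs (v w - v z) <= L * Cmod (w - z))%R).
  { intros z Hz.
    destruct (is_cderive_lipschitz _ _ _ (Hh' z Hz)) as [dh [Lh [Hdh [HLh Hh]]]].
    destruct (is_cderive_lipschitz _ _ _ (Hg' z Hz)) as [dg [Lg [Hdg [HLg Hg]]]].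
    exists (Rmin dh dg), (Lh + Lg)%R. split; [now apply Rmin_glb_lt|]. split; [lra|].
    intros w Hw. unfold disk in Hw. eapply Rle_trans; [apply Hv|].
    unfold f, harmonic_map.
    replace (h w + Cconj (g w) - (h z + Cconj (g z)))
      with ((h w - h z) + Cconj (g w - g z))
      by (rewrite Cminus_conj; ring).
    eapply Rle_trans; [apply Cmod_triangle|]. rewrite Cmod_conj.
    assert (Cmod (h w - h z) <= Lh * Cmod (w - z))%R
      by (apply Hh; eapply Rlt_le_trans; [exact Hw|apply Rmin_l]).
    assert (Cmod (g w - g z) <= Lg * Cmod (w - z))%R
      by (apply Hg; eapply Rlt_le_trans; [exact Hw|apply Rmin_r]).
    lra. }
  (* [eta] is the sign of [v] on the arm: the arm lies on one side of [f c]. *)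
  set (good := fun (e : C) (eta delta T : R) (sigma : R -> R) =>
    (0 < T)%R /\ (eta = 1 \/ eta = -1)%R /\
    (forall t, (0 < t < T)%R -> (Rabs (sigma t) <= delta)%R /\
       disk c eps (ray c e t (sigma t)) /\
       Re (phi (ray c e t (sigma t))) = Re (phi c) /\
       continuity_pt (fun t => eta * v (ray c e t (sigma t)))%R t /\
       (0 < eta * v (ray c e t (sigma t)))%R) /\
    (forall x, 0 < x -> exists d, 0 < d /\ forall t, 0 < t < d ->
       eta * v (ray c e t (sigma t)) < x)%R).
  assert (Harm : forall e, Cmod e = 1%R -> has_arm phi c e ->
    exists delta0, (0 < delta0)%R /\ forall delta, (0 < delta <= delta0)%R ->
      exists eta T sigma, good e eta delta T sigma).
  { intros e He [delta0 [Hd0 HA]]. exists (Rmin 1 delta0).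
    split; [apply Rmin_glb_lt; lra|]. intros delta [Hdelta Hle].
    assert (Hle1 : (delta <= 1)%R) by (eapply Rle_trans; [exact Hle|apply Rmin_l]).
    assert (Hle2 : (delta <= delta0)%R) by (eapply Rle_trans; [exact Hle|apply Rmin_r]).
    destruct (HA delta (conj Hdelta Hle2)) as [T0 [sigma [HT0 Hsig]]].
    destruct (Hlip c (disk_center c rho Hrho)) as [d0 [L0 [Hd00 [HL0 Hlip0]]]].
    set (T := (Rmin T0 (Rmin rho (Rmin eps d0)) / 2)%R).
    pose proof (Rmin_l T0 (Rmin rho (Rmin eps d0))) as M1.
    pose proof (Rmin_r T0 (Rmin rho (Rmin eps d0))) as M2.
    pose proof (Rmin_l rho (Rmin eps d0)) as M3.
    pose proof (Rmin_r rho (Rmin eps d0)) as M4.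
    pose proof (Rmin_l eps d0) as M5. pose proof (Rmin_r eps d0) as M6.
    assert (HT : (0 < T)%R).
    { unfold T. assert (0 < Rmin T0 (Rmin rho (Rmin eps d0)))%R
        by (repeat apply Rmin_glb_lt; lra). lra. }
    assert (Hbasic : forall t, (0 < t < T)%R ->
      (Cmod (ray c e t (sigma t) - c) <= 2 * t)%R /\
      (2 * t < rho)%R /\ (2 * t < eps)%R /\ (2 * t < d0)%R /\ (0 < t < T0)%R).
    { intros t Ht. unfold T in Ht. repeat split; try lra.
      apply Cmod_ray; [exact He|lra|]. destruct (Hsig t) as [Hs _]; lra. }
    assert (Hp : forall t, (0 < t < T)%R ->
      continuity_pt (fun t => v (ray c e t (sigma t))) t /\ v (ray c e t (sigma t)) <> 0%R).
    { intros t Ht. destruct (Hbasic t Ht) as [B1 [B2 [B3 [B4 B5]]]].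
      destruct (Hsig t B5) as [S1 [S2 S3]]. split.
      - intros x Hx. destruct (Hlip (ray c e t (sigma t))) as [d [L [Hd [HL Hlipd]]]].
        { unfold disk. lra. }
        destruct (ray_curve_continuous c e sigma t (Rmin d (x / L)) He S2) as [d' [Hd' Hcont]].
        { apply Rmin_glb_lt; [exact Hd|]. now apply Rdiv_lt_0_compat. }
        exists d'. split; [exact Hd'|]. intros t' [_ Ht'].
        specialize (Hcont t' Ht'). simpl. unfold Rdist.
        eapply Rle_lt_trans.
        + apply Hlipd. eapply Rlt_le_trans; [exact Hcont|apply Rmin_l].
        + assert (Hlt : (Cmod (ray c e t' (sigma t') - ray c e t (sigma t)) < x / L)%R)
            by (eapply Rlt_le_trans; [exact Hcont|apply Rmin_r]).
          apply Rlt_div_r in Hlt; [|exact HL]. lra.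
      - intros E. rewrite <- Hvc in E.
        assert (Ew : ray c e t (sigma t) = c).
        { apply Hinj; [unfold disk; lra|now apply disk_center|].
          apply Hsame; [exact S3|reflexivity|exact E]. }
        assert (E0 : RtoC t * (e * (1 + Ci * RtoC (sigma t))) = 0).
        { replace (RtoC t * (e * (1 + Ci * RtoC (sigma t)))) with (ray c e t (sigma t) - c)
            by (unfold ray; ring).
          rewrite Ew. ring. }
        revert E0. apply Cmult_neq_0; [intros E1; apply RtoC_inj in E1; lra|].
        apply Cmult_neq_0; [intros E1; rewrite E1, Cmod_0 in He; lra|].
        intros E1. apply (f_equal fst) in E1. simpl in E1. lra. }
    destruct (constant_sign _ T HT Hp) as [eta [Heta Hsign]].
    exists eta, T, sigma. unfold good. split; [exact HT|]. split; [exact Heta|]. split.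
    - intros t Ht. destruct (Hbasic t Ht) as [B1 [B2 [B3 [B4 B5]]]].
      destruct (Hsig t B5) as [S1 [S2 S3]].
      split; [exact S1|]. split; [unfold disk; lra|]. split; [exact S3|]. split.
      + apply (continuity_pt_scal (fun t => v (ray c e t (sigma t))) eta). now apply Hp.
      + now apply Hsign.
    - intros x Hx. exists (Rmin T (x / (2 * L0))). split.
      { apply Rmin_glb_lt; [exact HT|]. apply Rdiv_lt_0_compat; lra. }
      intros t Ht.
      assert (HtT : (0 < t < T)%R)
        by (split; [lra|eapply Rlt_le_trans; [apply Ht|apply Rmin_l]]).
      assert (Htx : (t < x / (2 * L0))%R) by (eapply Rlt_le_trans; [apply Ht|apply Rmin_r]).
      apply Rlt_div_r in Htx; [|lra].
      destruct (Hbasic t HtT) as [B1 [B2 [B3 [B4 B5]]]].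
      assert (Hd : disk c d0 (ray c e t (sigma t))) by (unfold disk; lra).
      specialize (Hlip0 _ Hd). rewrite Hvc, Rminus_0_r in Hlip0.
      apply Rle_lt_trans with (Rabs (v (ray c e t (sigma t)))).
      + destruct Heta; subst eta.
        * rewrite Rmult_1_l. apply Rle_abs.
        * replace (-1 * v (ray c e t (sigma t)))%R with (- v (ray c e t (sigma t)))%R by ring.
          rewrite <- Rabs_Ropp. apply Rle_abs.
      + nra. }
  assert (Hclash : forall e e' eta delta T sigma T' sigma',
    (forall t t' s s', (0 < t)%R -> (0 < t')%R -> (Rabs s <= delta)%R -> (Rabs s' <= delta)%R ->
       ray c e t s <> ray c e' t' s') ->
    good e eta delta T sigma -> good e' eta delta T' sigma' -> False).
  { intros e e' eta delta T sigma T' sigma' Hdisj [HT [Heta [HG HL]]] [HT' [_ [HG' HL']]].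
    destruct (common_value _ _ T T' HT HT'
      (fun t Ht => proj2 (proj2 (proj2 (HG t Ht))))
      (fun t Ht => proj2 (proj2 (proj2 (HG' t Ht)))) HL HL') as [t [t' [Ht [Ht' E]]]].
    destruct (HG t Ht) as [S1 [S2 [S3 _]]]. destruct (HG' t' Ht') as [S1' [S2' [S3' _]]].
    apply (Hdisj t t' (sigma t) (sigma' t')); try assumption; try lra.
    apply Hinj; [exact S2|exact S2'|]. apply Hsame; [exact S3|exact S3'|].
    destruct Heta; subst eta; lra. }
  destruct (three_arms _ c rho phi Hrho Hphi Hphi1)
    as [e1 [e2 [e3 [[He1 [He2 He3]] [[N12 [N13 N23]] [A1 [A2 A3]]]]]]].
  destruct (Harm e1 He1 A1) as [x1 [X1 G1]].
  destruct (Harm e2 He2 A2) as [x2 [X2 G2]].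
  destruct (Harm e3 He3 A3) as [x3 [X3 G3]].
  destruct (rays_disjoint c e1 e2 He1 He2 N12) as [y12 [Y12 D12]].
  destruct (rays_disjoint c e1 e3 He1 He3 N13) as [y13 [Y13 D13]].
  destruct (rays_disjoint c e2 e3 He2 He3 N23) as [y23 [Y23 D23]].
  assert (Hdelta : exists delta, (0 < delta)%R /\ (delta <= x1)%R /\ (delta <= x2)%R /\
    (delta <= x3)%R /\ (delta <= y12)%R /\ (delta <= y13)%R /\ (delta <= y23)%R).
  { exists (Rmin (Rmin x1 (Rmin x2 x3)) (Rmin y12 (Rmin y13 y23))).
    pose proof (Rmin_l (Rmin x1 (Rmin x2 x3)) (Rmin y12 (Rmin y13 y23))).
    pose proof (Rmin_r (Rmin x1 (Rmin x2 x3)) (Rmin y12 (Rmin y13 y23))).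
    pose proof (Rmin_l x1 (Rmin x2 x3)). pose proof (Rmin_r x1 (Rmin x2 x3)).
    pose proof (Rmin_l x2 x3). pose proof (Rmin_r x2 x3).
    pose proof (Rmin_l y12 (Rmin y13 y23)). pose proof (Rmin_r y12 (Rmin y13 y23)).
    pose proof (Rmin_l y13 y23). pose proof (Rmin_r y13 y23).
    repeat split; try lra. repeat apply Rmin_glb_lt; assumption. }
  destruct Hdelta as [delta [Hd [L1 [L2 [L3 [M12 [M13 M23]]]]]]].
  destruct (G1 delta (conj Hd L1)) as [eta1 [T1 [s1 H1]]].
  destruct (G2 delta (conj Hd L2)) as [eta2 [T2 [s2 H2]]].
  destruct (G3 delta (conj Hd L3)) as [eta3 [T3 [s3 H3]]].
  assert (E12 : eta1 <> eta2).
  { intros <-. apply (Hclash e1 e2 eta1 delta T1 s1 T2 s2); [|exact H1|exact H2].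
    intros. apply D12; lra. }
  assert (E13 : eta1 <> eta3).
  { intros <-. apply (Hclash e1 e3 eta1 delta T1 s1 T3 s3); [|exact H1|exact H3].
    intros. apply D13; lra. }
  assert (E23 : eta2 <> eta3).
  { intros <-. apply (Hclash e2 e3 eta2 delta T2 s2 T3 s3); [|exact H2|exact H3].
    intros. apply D23; lra. }
  destruct H1 as [_ [[->| ->] _]], H2 as [_ [[->| ->] _]], H3 as [_ [[->| ->] _]];
    congruence.
Qed.

(** * The harmonic Newton map *)

(** The Wirtinger derivative of [conj h'] vanishes, so only the analytic factors
    of [J = h' * conj h' - g' * conj g'] are differentiated. *)
Definition jacobian_dz (h g : C -> C) (z : C) : C :=
  C_derive (C_derive h) z * Cconj (C_derive h z)
  - C_derive (C_derive g) z * Cconj (C_derive g z).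

Definition newton_numerator (h g : C -> C) (z : C) : C :=
  Cconj (C_derive h z) * harmonic_map h g z - Cconj (C_derive g z * harmonic_map h g z).

Lemma jacobian_eq (h g : C -> C) (z : C) :
  RtoC (jacobian h g z)
  = C_derive h z * Cconj (C_derive h z) - C_derive g z * Cconj (C_derive g z).
Proof. unfold jacobian. now rewrite RtoC_minus, !Cmod2_conj. Qed.

Lemma wirtinger_C_derive (k : C -> C) (z : C) :
  analytic_at k z -> is_wirtinger (C_derive k) z (C_derive (C_derive k) z) 0.
Proof.
  intros H. apply wirtinger_analytic.
  now apply analytic_at_derive, analytic_at_derive.
Qed.

Lemma wirtinger_jacobian (h g : C -> C) (z : C) :
  analytic_at h z -> analytic_at g z ->
  exists b, is_wirtinger (fun w => RtoC (jacobian h g w)) z (jacobian_dz h g z) b.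
Proof.
  intros Hh Hg.
  pose proof (wirtinger_C_derive h z Hh) as H1.
  pose proof (wirtinger_C_derive g z Hg) as G1.
  pose proof (wirtinger_minus _ _ _ _ _ _ _
    (wirtinger_mult _ _ _ _ _ _ _ H1 (wirtinger_conj _ _ _ _ H1))
    (wirtinger_mult _ _ _ _ _ _ _ G1 (wirtinger_conj _ _ _ _ G1))) as HJ.
  eexists. refine (wirtinger_ext_loc _ _ _ _ _ 1 Rlt_0_1 _ _).
  - intros w _. symmetry. apply jacobian_eq.
  - match type of HJ with is_wirtinger _ _ ?a _ =>
      replace (jacobian_dz h g z) with a end.
    + exact HJ.
    + unfold jacobian_dz. rewrite Cconj_0. ring.
Qed.

(** Here [conj h'] and [conj g'] behave as constants under d/dz: this
    identity is what makes the harmonic Newton map have a critical point at the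
    zeros of [f]. *)
Lemma wirtinger_newton_numerator (h g : C -> C) (z : C) :
  analytic_at h z -> analytic_at g z ->
  exists b, is_wirtinger (newton_numerator h g) z (RtoC (jacobian h g z)) b.
Proof.
  intros Hh Hg.
  pose proof (wirtinger_analytic _ _ _ (proj1 (analytic_at_derive h z Hh))) as H0.
  pose proof (wirtinger_analytic _ _ _ (proj1 (analytic_at_derive g z Hg))) as G0.
  pose proof (wirtinger_C_derive h z Hh) as H1.
  pose proof (wirtinger_C_derive g z Hg) as G1.
  pose proof (wirtinger_plus _ _ _ _ _ _ _ H0 (wirtinger_conj _ _ _ _ G0)) as Hf.
  pose proof (wirtinger_minus _ _ _ _ _ _ _
    (wirtinger_mult _ _ _ _ _ _ _ (wirtinger_conj _ _ _ _ H1) Hf)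
    (wirtinger_conj _ _ _ _ (wirtinger_mult _ _ _ _ _ _ _ G1 Hf))) as HN.
  eexists. rewrite jacobian_eq.
  match type of HN with is_wirtinger _ _ ?a _ =>
    replace (C_derive h z * Cconj (C_derive h z) - C_derive g z * Cconj (C_derive g z))
      with a end.
  - exact HN.
  - repeat rewrite ?Cplus_conj, ?Cmult_conj, ?Cconj_0, ?Cconj_conj. ring.
Qed.

Definition newton_dz (h g : C -> C) (z : C) : C :=
  newton_numerator h g z
  * (jacobian_dz h g z * (/ RtoC (jacobian h g z) * / RtoC (jacobian h g z))).

Lemma wirtinger_newton (h g : C -> C) (z : C) :
  analytic_at h z -> analytic_at g z -> jacobian h g z <> 0%R ->
  exists b, is_wirtinger (harmonic_newton h g) z (newton_dz h g z) b.
Proof.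
  intros Hh Hg HJ.
  assert (HJ' : RtoC (jacobian h g z) <> 0) by (intros E; now apply RtoC_inj in E).
  destruct (wirtinger_jacobian h g z Hh Hg) as [bJ WJ].
  destruct (wirtinger_newton_numerator h g z Hh Hg) as [bN WN].
  pose proof (wirtinger_minus _ _ _ _ _ _ _ (wirtinger_id z)
    (wirtinger_mult _ _ _ _ _ _ _ WN (wirtinger_inv _ _ _ _ WJ HJ'))) as W.
  eexists.
  match type of W with is_wirtinger _ _ ?a _ => replace (newton_dz h g z) with a end.
  - exact W.
  - unfold newton_dz. now field.
Qed.

(** At a zero of the numerator the product rule leaves only the term where the
    numerator is differentiated, which contributes [J]. *)
Lemma wirtinger_newton_dz (h g : C -> C) (z : C) :
  analytic_at h z -> analytic_at g z -> jacobian h g z <> 0%R ->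
  newton_numerator h g z = 0 ->
  exists b, is_wirtinger (newton_dz h g) z (jacobian_dz h g z / RtoC (jacobian h g z)) b.
Proof.
  intros Hh Hg HJ HN0.
  assert (HJ' : RtoC (jacobian h g z) <> 0) by (intros E; now apply RtoC_inj in E).
  destruct (wirtinger_jacobian h g z Hh Hg) as [bJ WJ].
  destruct (wirtinger_newton_numerator h g z Hh Hg) as [bN WN].
  pose proof (analytic_at_derive _ _ Hh) as [_ Ah].
  pose proof (analytic_at_derive _ _ Hg) as [_ Ag].
  pose proof (wirtinger_minus _ _ _ _ _ _ _
    (wirtinger_mult _ _ _ _ _ _ _ (wirtinger_C_derive _ _ Ah)
       (wirtinger_conj _ _ _ _ (wirtinger_C_derive _ _ Hh)))
    (wirtinger_mult _ _ _ _ _ _ _ (wirtinger_C_derive _ _ Ag)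
       (wirtinger_conj _ _ _ _ (wirtinger_C_derive _ _ Hg)))) as WD.
  pose proof (wirtinger_inv _ _ _ _ WJ HJ') as WI.
  pose proof (wirtinger_mult _ _ _ _ _ _ _ WN
    (wirtinger_mult _ _ _ _ _ _ _ WD (wirtinger_mult _ _ _ _ _ _ _ WI WI))) as W.
  eexists.
  match type of W with is_wirtinger _ _ ?a _ =>
    replace (jacobian_dz h g z / RtoC (jacobian h g z)) with a end.
  - exact W.
  - rewrite HN0. unfold jacobian_dz. field. exact HJ'.
Qed.

Lemma jacobian_swap (h g : C -> C) (z : C) : jacobian g h z = (- jacobian h g z)%R.
Proof. unfold jacobian. ring. Qed.

Lemma pre_schwarzian_preserving_eq (h g : C -> C) (z : C) :
  analytic_at h z -> analytic_at g z -> (0 < jacobian h g z)%R ->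
  pre_schwarzian_preserving h g z = jacobian_dz h g z / RtoC (jacobian h g z).
Proof.
  intros Hh Hg HJ. destruct (wirtinger_jacobian h g z Hh Hg) as [b W].
  exact (wirtinger_dz _ _ _ _ (wirtinger_ln _ _ _ _ W HJ)).
Qed.

(** Exchanging [h] and [g] changes the sign of both [J] and its derivative, so the
    quotient does not depend on the orientation. *)
Lemma pre_schwarzian_eq (h g : C -> C) (z : C) :
  analytic_at h z -> analytic_at g z -> jacobian h g z <> 0%R ->
  pre_schwarzian h g z = jacobian_dz h g z / RtoC (jacobian h g z).
Proof.
  intros Hh Hg HJ.
  assert (HJ' : RtoC (jacobian h g z) <> 0) by (intros E; now apply RtoC_inj in E).
  pose proof (Cmod_ge_0 (C_derive h z)). pose proof (Cmod_ge_0 (C_derive g z)).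
  unfold pre_schwarzian. destruct (Rlt_dec _ _) as [Hlt|Hge].
  - apply pre_schwarzian_preserving_eq; [exact Hh|exact Hg|]. unfold jacobian. nra.
  - rewrite pre_schwarzian_preserving_eq; [|exact Hg|exact Hh|].
    + rewrite jacobian_swap, RtoC_opp. unfold jacobian_dz. now field.
    + rewrite jacobian_swap. unfold jacobian in *. nra.
Qed.

(** [J] vanishes exactly where [|h'| = |g'|], and both moduli are Lipschitz at
    [c]. *)
Lemma jacobian_neq_0_near (h g : C -> C) (c : C) :
  analytic_at h c -> analytic_at g c -> jacobian h g c <> 0%R ->
  exists eps : R, (0 < eps)%R /\ forall z, disk c eps z -> jacobian h g z <> 0%R.
Proof.
  intros Hh Hg HJ.
  assert (Hmod : forall k, analytic_at k c -> exists d L, (0 < d)%R /\ (0 < L)%R /\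
    forall w, disk c d w ->
      (Rabs (Cmod (C_derive k w) - Cmod (C_derive k c)) <= L * Cmod (w - c))%R).
  { intros k Hk.
    destruct (is_cderive_lipschitz _ _ _
      (proj1 (analytic_at_derive _ _ (proj2 (analytic_at_derive _ _ Hk)))))
      as [d [L [Hd [HL H]]]].
    exists d, L. repeat split; try assumption. intros w Hw.
    eapply Rle_trans; [|apply (H w Hw)].
    apply (@norm_triangle_inv C_AbsRing C_NormedModule). }
  destruct (Hmod h Hh) as [d1 [L1 [Hd1 [HL1 H1]]]].
  destruct (Hmod g Hg) as [d2 [L2 [Hd2 [HL2 H2]]]].
  set (A := Cmod (C_derive h c)) in *. set (B := Cmod (C_derive g c)) in *.
  assert (HA : (0 <= A)%R) by apply Cmod_ge_0. assert (HB : (0 <= B)%R) by apply Cmod_ge_0.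
  assert (HAB : A <> B).
  { intros E. apply HJ. unfold jacobian. fold A B. rewrite E. ring. }
  assert (Hgap : (0 < Rabs (A - B))%R) by (apply Rabs_pos_lt; lra).
  set (e := (Rabs (A - B) / (L1 + L2))%R).
  assert (He : (0 < e)%R) by (apply Rdiv_lt_0_compat; lra).
  exists (Rmin d1 (Rmin d2 e)). split; [repeat apply Rmin_glb_lt; assumption|].
  intros z Hz HJz. unfold disk in Hz.
  assert (Z1 : (Cmod (z - c) < d1)%R) by (eapply Rlt_le_trans; [exact Hz|apply Rmin_l]).
  assert (Z2 : (Cmod (z - c) < d2)%R)
    by (eapply Rlt_le_trans; [exact Hz|]; eapply Rle_trans; [apply Rmin_r|apply Rmin_l]).
  assert (Z3 : (Cmod (z - c) < e)%R)
    by (eapply Rlt_le_trans; [exact Hz|]; eapply Rle_trans; apply Rmin_r).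
  specialize (H1 z Z1). specialize (H2 z Z2).
  assert (E : Cmod (C_derive h z) = Cmod (C_derive g z)).
  { unfold jacobian in HJz. pose proof (Cmod_ge_0 (C_derive h z)).
    pose proof (Cmod_ge_0 (C_derive g z)). nra. }
  rewrite E in H1.
  apply Rlt_div_r in Z3; [|lra].
  set (x := Cmod (C_derive g z)) in *.
  pose proof (Rabs_triang (- (x - A)) (x - B)) as Ht. rewrite Rabs_Ropp in Ht.
  replace (- (x - A) + (x - B))%R with (A - B)%R in Ht by ring. lra.
Qed.

Theorem proposition1 (h g : C -> C) (alpha : C) (r : R)
    (r_pos : (0 < r)%R)
    (h_analytic : analytic_on (disk alpha r) h)
    (g_analytic : analytic_on (disk alpha r) g)
    (f_univalent : locally_univalent_on (disk alpha r) (harmonic_map h g))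
    (f_zero : harmonic_map h g alpha = 0) :
  let F := harmonic_newton h g in
  F alpha = alpha /\
  (exists eps : R, (0 < eps)%R /\ forall z : C, disk alpha eps z -> ex_dz F z) /\
  dz F alpha = 0 /\
  ex_dz (dz F) alpha /\
  dz (dz F) alpha = pre_schwarzian h g alpha.
Proof.
  intros F.
  pose proof (disk_center alpha r r_pos) as Hin.
  assert (HJ : jacobian h g alpha <> 0%R).
  { destruct (f_univalent alpha Hin) as [d [Hd Hinj]].
    apply (lewy_jacobian_neq_0 h g alpha (Rmin r d)); [now apply h_analytic|now apply g_analytic| |].
    - now apply Rmin_glb_lt.
    - intros w1 w2 H1 H2.
      apply Hinj; (eapply Rlt_le_trans; [eassumption|]); first [apply Rmin_l|apply Rmin_r]. }
  assert (HN : newton_numerator h g alpha = 0).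
  { unfold newton_numerator. rewrite f_zero, !Cmult_0_r, Cconj_0. ring. }
  destruct (jacobian_neq_0_near h g alpha) as [d [Hd HJd]];
    [now apply h_analytic|now apply g_analytic|exact HJ|].
  assert (Heps : (0 < Rmin r d)%R) by now apply Rmin_glb_lt.
  assert (HW : forall z, disk alpha (Rmin r d) z ->
            exists b, is_wirtinger F z (newton_dz h g z) b).
  { intros z Hz.
    assert (Hz1 : disk alpha r z) by (eapply Rlt_le_trans; [exact Hz|apply Rmin_l]).
    assert (Hz2 : disk alpha d z) by (eapply Rlt_le_trans; [exact Hz|apply Rmin_r]).
    apply wirtinger_newton; [now apply h_analytic|now apply g_analytic|now apply HJd]. }
  assert (HD : exists b, is_wirtinger (dz F) alpha
            (jacobian_dz h g alpha / RtoC (jacobian h g alpha)) b).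
  { destruct (wirtinger_newton_dz h g alpha) as [b W];
      [now apply h_analytic|now apply g_analytic|exact HJ|exact HN|].
    exists b. apply (wirtinger_ext_loc (newton_dz h g) (dz F) alpha _ _ _ Heps); [|exact W].
    intros z Hz. destruct (HW z Hz) as [b' W']. symmetry. exact (wirtinger_dz _ _ _ _ W'). }
  destruct HD as [b WD].
  repeat split.
  - unfold F, harmonic_newton. fold (newton_numerator h g alpha). rewrite HN.
    unfold Cdiv. ring.
  - exists (Rmin r d). split; [exact Heps|]. intros z Hz.
    destruct (HW z Hz) as [b' W]. exact (wirtinger_ex_dz _ _ _ _ W).
  - destruct (HW alpha (disk_center _ _ Heps)) as [b' W].
    rewrite (wirtinger_dz _ _ _ _ W). unfold newton_dz. rewrite HN. ring.
  - apply (wirtinger_ex_dz _ _ _ _ WD).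
  - apply (wirtinger_ex_dz _ _ _ _ WD).
  - rewrite (wirtinger_dz _ _ _ _ WD). symmetry.
    apply pre_schwarzian_eq; [now apply h_analytic|now apply g_analytic|exact HJ].
Qed.
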